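(* Let $\mu$ be a partition of $n+1$ and let $(i,j)\in\mu$ be a cell of its diagram. Let $\ell$ be the number of cells of $\mu$ north of $(i,j)$ (cells $(r,j)\in\mu$ with $r>i$) and let $a$ be the number of cells of $\mu$ east of $(i,j)$ (cells $(i,c)\in\mu$ with $c>j$). Let $H^0_{\mu/i,j}$ denote the graded Frobenius characteristic of $M^0_{\mu/ij}$, with the convention that $H^0_{\mu/r,c}=0$ whenever $(r,c)\notin\mu$. Then: 1. if $a=0$ and $\ell>0$, $\displaystyle H^0_{\mu/i,j}=\frac{t^{\ell+1}-1}{t^{\ell}-1}\,H^0_{\mu/i+1,j}$; 2. if $a>0$, $\displaystyle H^0_{\mu/i,j}=H^0_{\mu/i,j+1}+t\,H^0_{\mu/i+1,j}-t\,H^0_{\mu/i+1,j+1}$; 3. if $a=0$ and $\ell=0$, $H^0_{\mu/i,j}$ is the graded Frobenius characteristic of $M^0_\nu$, where $\nu$ is the partition $\mu/ij$.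
   Context: **Diagrams.** A lattice diagram is a finite subset $D\subset\mathbb N\times\mathbb N$ (with $0\in\mathbb N$); its elements $(r,c)$ are cells, with $r$ the row index and $c$ the column index (both starting at $0$; rows are counted from bottom to top, columns from left to right). A partition $\mu=(\mu_1\ge\mu_2\ge\cdots\ge\mu_k>0)$ is identified with its diagram $\{(r,c): 0\le r\le k-1,\ 0\le c\le \mu_{r+1}-1\}$. For $(i,j)\in\mu$, $\mu/ij$ (also written $\mu/i,j$) denotes the lattice diagram $\mu\setminus\{(i,j)\}$. **Spaces.** For $D=\{(r_1,c_1),\ldots,(r_n,c_n)\}$ with $n$ cells, listed in increasing lexicographic order, and variables $X=x_1,\ldots,x_n$, $Y=y_1,\ldots,y_n$, put $\Delta_D(X;Y)=\det\|x_s^{r_t}y_s^{c_t}\|_{s,t=1}^n\in\mathbb Q[X,Y]$. $M_D$ is the $\mathbb Q$-linear span of all partial derivatives, of all orders (including order $0$) and with respect to all the variables, of $\Delta_D$. It is bigraded by degree in $X$ and degree in $Y$; $\mathcal H_{r,s}[M_D]$ denotes the component of degree $r$ in $X$ and $s$ in $Y$. The $Y$-free component is $M_D^0=\bigoplus_{r\ge0}\mathcal H_{r,0}[M_D]$. **Frobenius characteristic.** The symmetric group $\mathcal S_n$ acts diagonally on $\mathbb Q[X,Y]$ by $\sigma P(X;Y)=P(x_{\sigma_1},\ldots,x_{\sigma_n};y_{\sigma_1},\ldots,y_{\sigma_n})$, and each $\mathcal H_{r,s}[M_D]$ is invariant. The graded Frobenius characteristic of $M_D^0$ is $$H_D^0=\sum_{r\ge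 0}t^r\,\mathcal F\big(\mathrm{ch}\,\mathcal H_{r,0}[M_D]\big),$$ where $\mathrm{ch}$ denotes the $\mathcal S_n$-character and $\mathcal F$ is the linear Frobenius map sending the irreducible character $\chi^\lambda$ to the Schur function $s_\lambda$. *)

(* Defs.v *)
From Stdlib Require Import ClassicalEpsilon.
From mathcomp Require Import all_boot all_order all_fingroup all_algebra.
From mathcomp Require Import finmap.
From mathcomp Require Import mpoly.

Set Implicit Arguments.
Unset Strict Implicit.
Unset Printing Implicit Defensive.

Import Order.TTheory GRing.Theory.
Local Open Scope fset_scope.
Local Open Scope ring_scope.

(* Linear subspaces of a possibly infinite-dimensional space (such as a
   polynomial ring) are represented by Prop-valued predicates.               *)

Section Subspaces.

Variables (F : fieldType) (V : lmodType F).

Definition in_span (S : V -> Prop) (v : V) : Prop :=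
  exists k (c : 'I_k -> F) (e : 'I_k -> V),
    (forall i, S (e i)) /\ v = \sum_(i < k) c i *: e i.

Definition is_basis (U : V -> Prop) (k : nat) (e : 'I_k -> V) : Prop :=
  [/\ forall i, U (e i),
      forall c : 'I_k -> F, \sum_(i < k) c i *: e i = 0 -> forall i, c i = 0
    & forall v, U v -> exists c : 'I_k -> F, v = \sum_(i < k) c i *: e i].

Definition is_trace (U : V -> Prop) (f : V -> V) (x : F) : Prop :=
  exists k (e : 'I_k -> V) (A : 'M[F]_k),
    [/\ is_basis U e,
        forall i, f (e i) = \sum_(j < k) A i j *: e j
      & x = \tr A].

(* The trace of f on U; this is only meaningful when U is finite-dimensional
   and stable under the linear map f, and then is_trace U f has exactly one
   solution.                                                                 *)
Definition trace (U : V -> Prop) (f : V -> V) : F :=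
  epsilon (inhabits 0) (is_trace U f).

End Subspaces.

(* Lattice diagrams: u.1 is the row and u.2 is the column of the cell u.     *)

Notation diag := {fset nat * nat}.

Definition lexle (u v : nat * nat) : bool :=
  (u.1 < v.1)%N || ((u.1 == v.1) && (u.2 <= v.2)%N).

Definition cell (D : diag) (k : nat) : nat * nat :=
  nth (0%N, 0%N) (sort lexle (enum_fset D)) k.

Definition is_part_of (n : nat) (la : seq nat) : bool :=
  [&& sorted geq la, 0%N \notin la & sumn la == n].

Definition part_diag (la : seq nat) : diag :=
  [fset u in [seq (r, c) | r <- iota 0 (size la), c <- iota 0 (nth 0%N la r)]].

Definition leg (D : diag) (i j : nat) : nat :=
  #|` [fset u in D | (u.2 == j) && (i < u.1)%N]|.

Definition arm (D : diag) (i j : nat) : nat :=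
  #|` [fset u in D | (u.1 == i) && (j < u.2)%N]|.

(* In {mpoly rat[n + n]} the first n variables are x_1, ..., x_n and the last
   n variables are y_1, ..., y_n.                                            *)

Definition varX n (i : 'I_n) : {mpoly rat[n + n]} := 'X_(lshift n i).
Definition varY n (i : 'I_n) : {mpoly rat[n + n]} := 'X_(rshift n i).

Definition degX n (m : 'X_{1..n + n}) : nat := (\sum_(i < n) m (lshift n i))%N.
Definition degY n (m : 'X_{1..n + n}) : nat := (\sum_(i < n) m (rshift n i))%N.

Definition bihomog n (r s : nat) (p : {mpoly rat[n + n]}) : Prop :=
  forall m, m \in msupp p -> degX m = r /\ degY m = s.

Definition Delta (D : diag) : {mpoly rat[#|` D| + #|` D|]} :=
  \det (\matrix_(s, t < #|` D|)
          (varX s ^+ (cell D t).1 * varY s ^+ (cell D t).2)).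

Definition M (D : diag) : {mpoly rat[#|` D| + #|` D|]} -> Prop :=
  in_span (fun q => exists m : 'X_{1..#|` D| + #|` D|}, q = (Delta D)^`M[m]).

Definition HM (D : diag) (r s : nat) (p : {mpoly rat[#|` D| + #|` D|]}) : Prop :=
  @M D p /\ bihomog r s p.

Definition subst_vars n (f : 'I_n -> 'I_n) (p : {mpoly rat[n]}) : {mpoly rat[n]} :=
  p \mPo [tuple 'X_(f i) | i < n].

Definition diag_perm n (s : 'S_n) (k : 'I_(n + n)) : 'I_(n + n) :=
  match split k with
  | inl i => lshift n (s i)
  | inr i => rshift n (s i)
  end.

Definition chHM (D : diag) (r s : nat) (sigma : 'S_#|` D|) : rat :=
  trace (@HM D r s) (subst_vars (diag_perm sigma)).

(* The irreducible character chi^la is that of the Specht module, realized as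
   the span of the Specht polynomials
     prod (x_T(u) - x_T(v)), u below v in the same column of la,
   over all bijective fillings T of the diagram of la |- n.                  *)

Definition specht_poly n (D : diag) (T : {ffun D -> 'I_n}) : {mpoly rat[n]} :=
  \prod_(u : D) \prod_(v : D | ((val u).2 == (val v).2)
                               && ((val u).1 < (val v).1)%N)
     ('X_(T u) - 'X_(T v)).

Definition specht n (la : seq nat) : {mpoly rat[n]} -> Prop :=
  in_span (fun q => exists T : {ffun part_diag la -> 'I_n},
                      bijective T /\ q = specht_poly T).

Definition irr_char n (la : seq nat) (sigma : 'S_n) : rat :=
  trace (@specht n la) (subst_vars sigma).

Definition char_dot n (phi psi : 'S_n -> rat) : rat :=
  (n`!%:R)^-1 * \sum_(s : 'S_n) phi s * psi (s^-1)%g.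

(* Symmetric functions have coefficients in the field Q(t). A symmetric
   function is given by its restrictions to N variables, for all N : nat, so
   that an identity of symmetric functions is an identity for every N.       *)

Notation Qt := {fraction {poly rat}}.

Definition t : Qt := tofrac 'X.

Definition semistandard N (D : diag) (T : {ffun D -> 'I_N}) : bool :=
  [forall u : D, forall v : D,
     (((val u).1 == (val v).1) && ((val u).2 <= (val v).2)%N
        ==> (T u <= T v)%N)
     && (((val u).2 == (val v).2) && ((val u).1 < (val v).1)%N
        ==> (T u < T v)%N)].

Definition schur N (la : seq nat) : {mpoly Qt[N]} :=
  \sum_(T : {ffun part_diag la -> 'I_N} | semistandard T)
     \prod_(u : part_diag la) 'X_(T u).

(* The linear map sending chi^la to s_la; a partition of n has at most n
   parts, all of them at most n.                                             *)
Definition frobenius n N (phi : 'S_n -> rat) : {mpoly Qt[N]} :=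
  \sum_(la : {bseq n of 'I_n.+1} | is_part_of n (map val la))
     tofrac (char_dot phi (@irr_char n (map val la)))%:P *: schur N (map val la).

(* H_{r,0}[M_D] is zero for r >= msize (Delta D).                            *)
Definition H0 N (D : diag) : {mpoly Qt[N]} :=
  \sum_(r < msize (Delta D)) t ^+ r *: frobenius N (@chHM D r 0).

Definition H0_minus N (mu : seq nat) (r c : nat) : {mpoly Qt[N]} :=
  if (r, c) \in part_diag mu then H0 N (part_diag mu `\ (r, c)) else 0.

(* Main.v *)
(* Since M_D is closed under derivation and bigraded, its Y-free part is spanned by the
   X-derivatives of the polynomials obtained from Delta_D by a maximal derivation in Y:
   the determinants [gen d f] in which a map f prescribes the column of each variable.

   Let h 0 >= h 1 >= ... be the column heights of mu, and let c be the last column with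
   h c > i.  The operator D = d/dx_1 + ... + d/dx_n maps M^0_{mu/ij} onto
   M^0_{mu/i+1,j}, lowering the degree by one, with kernel M^0_nu, where nu is mu with
   the top cell of column c removed.  Hence
     H_{mu/ij} = H_nu + t H_{mu/i+1,j},
   where nu depends on i only, and the three claims follow.

   That M^0_nu lies in M^0_{mu/ij} is a Garnir relation: differentiating a determinant
   along "replace column j by column c" row by row or column by column gives the same
   result.  For the opposite inclusion, M^0_mu is identified, by induction on the number
   of variables, with the space T_mu killed by the Tanisaki ideal: if P in T_mu has degree
   at most r in one variable x, its coefficient of x^r lies in T_{mu minus a corner}.  An
   element of M^0_{mu/ij} is the coefficient of x^i in some R in M^0_mu; as R is
   translation invariant, if D kills this coefficient then it is the leading one. *)

Require Import Defs.
From mathcomp Require Import all_boot all_order all_fingroup all_algebra.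
From mathcomp Require Import finmap.
From mathcomp Require Import mpoly.
From Stdlib Require Import ClassicalEpsilon.
From HB Require Import structures.
From mathcomp Require Import zify ring.

Set Implicit Arguments.
Unset Strict Implicit.
Unset Printing Implicit Defensive.

Import GRing.Theory.
Local Open Scope fset_scope.
Local Open Scope ring_scope.

(** * Subspaces and traces *)

Section LinearAlgebra.

Context {F : fieldType}.
Implicit Types V W : lmodType F.

Definition subspace {V} (U : V -> Prop) : Prop :=
  U 0 /\ forall a u v, U u -> U v -> U (a *: u + v).

Lemma subspaceD V (U : V -> Prop) u v : subspace U -> U u -> U v -> U (u + v).
Proof. by move=> [_ h] hu hv; rewrite -[u]scale1r; apply: h. Qed.

Lemma subspaceZ V (U : V -> Prop) a u : subspace U -> U u -> U (a *: u).
Proof. by move=> [h0 h] hu; rewrite -[_ *: _]addr0; apply: h. Qed.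

Lemma subspaceB V (U : V -> Prop) u v : subspace U -> U u -> U v -> U (u - v).
Proof.
by move=> hU hu hv; rewrite -scaleN1r; apply: subspaceD => //; apply: subspaceZ.
Qed.

Lemma subspace_sum V (U : V -> Prop) (I : Type) (r : seq I) (P : pred I)
    (e : I -> V) :
  subspace U -> (forall i, P i -> U (e i)) -> U (\sum_(i <- r | P i) e i).
Proof.
move=> hU he; apply: (big_ind U) => //; first by case: hU.
by move=> u v; apply: subspaceD.
Qed.

Lemma subspaceI V (U U' : V -> Prop) :
  subspace U -> subspace U' -> subspace (fun u => U u /\ U' u).
Proof.
move=> [U0 hU] [U'0 hU']; split=> // a u v [? ?] [? ?].
by split; [apply: hU | apply: hU'].
Qed.

Lemma subspace_preim V W (phi : {linear V -> W}) (U : W -> Prop) :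
  subspace U -> subspace (fun v => U (phi v)).
Proof.
by move=> [h0 h]; split=> [|a u v ? ?]; rewrite ?linear0 ?linearP //; apply: h.
Qed.

Lemma subspace_im V W (phi : {linear V -> W}) (U : V -> Prop) :
  subspace U -> subspace (fun w => exists2 u, U u & w = phi u).
Proof.
move=> [h0 h]; split=> [|a _ _ [u Uu ->] [v Uv ->]].
  by exists 0; rewrite ?linear0.
by exists (a *: u + v); rewrite ?linearP //; apply: h.
Qed.

Lemma subspace_ker V W (phi : {linear V -> W}) :
  subspace (fun v => phi v = 0).
Proof.
by split=> [|a u v hu hv]; rewrite ?linear0 // linearP hu hv scaler0 addr0.
Qed.

Lemma in_span_subspace V (S : V -> Prop) : subspace (in_span S).
Proof.
split; first by exists 0, (fun _ => 0), (fun _ => 0); split; [case|rewrite big_ord0].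
move=> a _ _ [k [c [e [Se ->]]]] [k' [c' [e' [Se' ->]]]].
exists (k + k')%N.
exists (fun i => match split i with inl i => a * c i | inr j => c' j end).
exists (fun i => match split i with inl i => e i | inr j => e' j end); split.
  by move=> i; case: split.
rewrite big_split_ord scaler_sumr; congr (_ + _); apply: eq_bigr => i _.
  by rewrite (unsplitK (inl i : _ + 'I_k')) scalerA.
by rewrite (unsplitK (inr i : 'I_k + _)).
Qed.

Lemma mem_span V (S : V -> Prop) v : S v -> in_span S v.
Proof.
move=> Sv; exists 1, (fun _ => 1), (fun _ => v); split=> //.
by rewrite big_ord1 scale1r.
Qed.

Lemma in_span_min V (S U : V -> Prop) :
  subspace U -> (forall v, S v -> U v) -> forall v, in_span S v -> U v.
Proof.
move=> hU hS _ [k [c [e [Se ->]]]]; apply: subspace_sum => // i _.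
by apply: subspaceZ => //; apply: hS.
Qed.

Lemma basis_coord_inj V (U : V -> Prop) k (e : 'I_k -> V) (c d : 'I_k -> F) :
  is_basis U e -> \sum_(i < k) c i *: e i = \sum_(i < k) d i *: e i ->
  forall i, c i = d i.
Proof.
move=> [_ free _] h i; apply/eqP; rewrite -subr_eq0; apply/eqP.
apply: (free (fun i => c i - d i)).
under eq_bigr do rewrite scalerBl.
by rewrite sumrB h subrr.
Qed.

Lemma basis_matrix V (U : V -> Prop) k (e : 'I_k -> V) m (w : 'I_m -> V) :
  is_basis U e -> (forall i, U (w i)) ->
  exists A : 'M[F]_(m, k), forall i, w i = \sum_(j < k) A i j *: e j.
Proof.
move=> [_ _ gen] Uw.
have h i : {c : 'I_k -> F | w i = \sum_(j < k) c j *: e j}.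
  by apply: constructive_indefinite_description; apply: gen.
exists (\matrix_(i, j) sval (h i) j) => i.
by rewrite {1}(svalP (h i)); apply: eq_bigr => j _; rewrite mxE.
Qed.

Lemma sum_mulmx V k m l (A : 'M[F]_(m, k)) (B : 'M[F]_(k, l)) (e : 'I_l -> V) i :
  \sum_(j < k) A i j *: (\sum_(p < l) B j p *: e p)
  = \sum_(p < l) (A *m B) i p *: e p.
Proof.
under eq_bigr do rewrite scaler_sumr.
rewrite exchange_big; apply: eq_bigr => p _ /=.
by rewrite mxE scaler_suml; apply: eq_bigr => j _; rewrite scalerA.
Qed.

(** The transition matrices [C] and [C'] between the two bases are a priori rectangular. From
    [C'C = 1], [CC' = 1] and [CA = A'C], cyclicity gives [tr A = tr (CAC') = tr A'], without
    comparing [k] and [k'] first. *)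
Lemma is_trace_uniq V (U : V -> Prop) (f : {linear V -> V}) x y :
  is_trace U f x -> is_trace U f y -> x = y.
Proof.
move=> [k [e [A [be fe ->]]]] [k' [e' [A' [be' fe' ->]]]].
have [C hC] := basis_matrix be (fun i => let: And3 h _ _ := be' in h i).
have [C' hC'] := basis_matrix be' (fun i => let: And3 h _ _ := be in h i).
have mxinj m (B B' : 'M[F]_(m, k)) :
    (forall i, \sum_j B i j *: e j = \sum_j B' i j *: e j) -> B = B'.
  by move=> h; apply/matrixP => i j; apply: basis_coord_inj be (h i) j.
have mxinj' m (B B' : 'M[F]_(m, k')) :
    (forall i, \sum_j B i j *: e' j = \sum_j B' i j *: e' j) -> B = B'.
  by move=> h; apply/matrixP => i j; apply: basis_coord_inj be' (h i) j.
have C'C : C' *m C = 1%:M.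
  apply: mxinj => i; rewrite -sum_mulmx -(eq_bigr _ (fun j _ => congr1 _ (hC j))).
  rewrite -hC' (bigD1 i) //= mxE eqxx scale1r big1 ?addr0 // => j ne.
  by rewrite mxE eq_sym (negbTE ne) scale0r.
have CC' : C *m C' = 1%:M.
  apply: mxinj' => i; rewrite -sum_mulmx -(eq_bigr _ (fun j _ => congr1 _ (hC' j))).
  rewrite -hC (bigD1 i) //= mxE eqxx scale1r big1 ?addr0 // => j ne.
  by rewrite mxE eq_sym (negbTE ne) scale0r.
have CA : C *m A = A' *m C.
  apply: mxinj => i; rewrite -!sum_mulmx.
  rewrite -(eq_bigr _ (fun j _ => congr1 _ (fe j))).
  rewrite -(eq_bigr _ (fun j _ => congr1 _ (hC j))) -fe' hC linear_sum.
  by apply: eq_bigr => j _; rewrite linearZ.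
by rewrite -[A]mul1mx -C'C -mulmxA mxtrace_mulC CA -mulmxA CC' mulmx1.
Qed.

Lemma trace_eq V (U : V -> Prop) (f : {linear V -> V}) x :
  is_trace U f x -> trace U f = x.
Proof.
move=> h; apply: (is_trace_uniq (U := U) (f := f)) => //.
by apply: (@epsilon_spec F _ (is_trace U f)); exists x.
Qed.

Definition findim {V} (U : V -> Prop) : Prop :=
  exists k (e : 'I_k -> V), is_basis U e.

Definition cat_fam (A : Type) k l (e : 'I_k -> A) (w : 'I_l -> A)
  (i : 'I_(k + l)) : A :=
  match split i with inl i => e i | inr j => w j end.

Lemma cat_fam_l A k l (e : 'I_k -> A) (w : 'I_l -> A) i :
  cat_fam e w (lshift l i) = e i.
Proof. by rewrite /cat_fam (unsplitK (inl i : _ + 'I_l)). Qed.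

Lemma cat_fam_r A k l (e : 'I_k -> A) (w : 'I_l -> A) i :
  cat_fam e w (rshift k i) = w i.
Proof. by rewrite /cat_fam (unsplitK (inr i : 'I_k + _)). Qed.

(** * Traces in exact sequences *)

Section ExactSequence.

Context {V W : lmodType F} (phi : {linear V -> W}) (U : V -> Prop).
Hypothesis hU : subspace U.
Let K v := U v /\ phi v = 0.
Let I w := exists2 u, U u & w = phi u.

Lemma basis_exact k (e : 'I_k -> V) l (w : 'I_l -> V) :
  is_basis K e -> (forall i, U (w i)) -> is_basis I (phi \o w) ->
  is_basis U (cat_fam e w).
Proof.
move=> [Ke freee gene] Uw [Iw freew genw]; split.
- by move=> i; rewrite /cat_fam; case: split => j; [case: (Ke j)|].
- move=> c; rewrite big_split_ord /=.
  under eq_bigr do rewrite cat_fam_l.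
  under [X in _ + X]eq_bigr do rewrite cat_fam_r.
  move=> h0.
  have cr : forall i, c (rshift k i) = 0.
    apply: (freew (fun i => c (rshift k i))); move/(congr1 phi): h0.
    rewrite linearD linear0 !linear_sum big1 ?add0r.
      by move=> h0; rewrite -[RHS]h0; apply: eq_bigr => i _; rewrite linearZ.
    by move=> i _; rewrite linearZ /=; case: (Ke i) => _ ->; rewrite scaler0.
  have cl : forall i, c (lshift l i) = 0.
    apply: (freee (fun i => c (lshift l i))).
    rewrite -[RHS]h0 [X in _ = _ + X]big1 ?addr0 // => i _.
    by rewrite cr scale0r.
  by move=> i; rewrite -[i]splitK; case: split.
move=> v Uv; have [c hc] : exists c : 'I_l -> F, phi v = \sum_i c i *: phi (w i).
  by apply: genw; exists v.
have [d hd] : exists d : 'I_k -> F, v - \sum_i c i *: w i = \sum_i d i *: e i.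
  apply: gene; split.
    apply: subspaceB => //; apply: subspace_sum => // i _.
    exact: subspaceZ.
  rewrite linearB linear_sum hc; apply/eqP; rewrite subr_eq0; apply/eqP.
  by apply: eq_bigr => i _; rewrite linearZ.
exists (cat_fam d c); rewrite big_split_ord /=.
under eq_bigr do rewrite !cat_fam_l.
under [X in _ + X]eq_bigr do rewrite !cat_fam_r.
by rewrite -hd subrK.
Qed.

Lemma basis_im l (y : 'I_l -> W) :
  is_basis I y -> exists w : 'I_l -> V,
    (forall i, U (w i)) /\ is_basis I (phi \o w).
Proof.
move=> by_; have h i : {u | U u /\ y i = phi u}.
  apply: constructive_indefinite_description.
  by case: by_ => Iy _ _; case: (Iy i) => u ? ?; exists u.
exists (fun i => sval (h i)); split; first by move=> i; case: (svalP (h i)).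
have e i : phi (sval (h i)) = y i by case: (svalP (h i)).
case: by_ => Iy freey geny; split=> [i|c|v /geny [c ->]].
- by rewrite /= e.
- by under eq_bigr do rewrite /= e; apply: freey.
- by exists c; apply: eq_bigr => i _; rewrite /= e.
Qed.

Lemma findim_exact : findim K -> findim I -> findim U.
Proof.
move=> [k [e be]] [l [y /basis_im [w [Uw bw]]]].
by exists (k + l)%N, (cat_fam e w); apply: basis_exact.
Qed.

(** In the basis of [basis_exact] the matrix of [f] is block triangular, because [f] preserves the
    kernel. Its diagonal blocks are the matrices of [f] on the kernel and of [g] on the image. *)
Lemma trace_exact (f : {linear V -> V}) (g : {linear W -> W}) :
  (forall u, U u -> U (f u)) -> (forall u, U u -> phi (f u) = g (phi u)) ->
  findim K -> findim I -> trace U f = trace K f + trace I g.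
Proof.
move=> Uf fg [k [e be]] [l [y /basis_im [w [Uw bw]]]].
have bU := basis_exact be Uw bw.
have Ke i : K (e i) by case: be.
have Kfe i : K (f (e i)).
  case: (Ke i) => Ue pe; split; first exact: Uf.
  by rewrite fg // pe linear0.
have [A hA] := basis_matrix be Kfe.
have [B hB] := basis_matrix bU (fun i => Uf _ (Uw i)).
have BE i : f (w i) = \sum_(j < k) lsubmx B i j *: e j
                      + \sum_(j < l) rsubmx B i j *: w j.
  rewrite hB big_split_ord /=; congr (_ + _); apply: eq_bigr => j _.
    by rewrite cat_fam_l mxE.
  by rewrite cat_fam_r mxE.
have -> : trace K f = \tr A by apply: trace_eq; exists k, e, A.
have -> : trace I g = \tr (rsubmx B).
  apply: trace_eq; exists l, (phi \o w), (rsubmx B); split=> // i /=.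
  rewrite -fg // BE linearD !linear_sum big1 ?add0r.
    by apply: eq_bigr => j _; rewrite linearZ.
  by move=> j _; rewrite linearZ /=; case: (Ke j) => _ ->; rewrite scaler0.
rewrite -(mxtrace_block A 0 (lsubmx B)).
apply: trace_eq.
exists (k + l)%N, (cat_fam e w), (block_mx A 0 (lsubmx B) (rsubmx B)).
split=> // i; rewrite big_split_ord /=.
under eq_bigr do rewrite cat_fam_l.
under [X in _ + X]eq_bigr do rewrite cat_fam_r.
rewrite -[i]splitK; case: split => i' /=.
  rewrite cat_fam_l hA.
  under eq_bigr do rewrite block_mxEul.
  rewrite [X in _ = _ + X]big1 ?addr0 // => j _.
  by rewrite block_mxEur mxE scale0r.
rewrite cat_fam_r BE; congr (_ + _); apply: eq_bigr => j _.
  by rewrite block_mxEdl.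
by rewrite block_mxEdr.
Qed.

End ExactSequence.

Lemma findim0 V : findim (fun v : V => v = 0).
Proof.
exists 0%N, (fun _ => 0); split=> [[]|c _ []|v ->] //.
by exists (fun _ => 0); rewrite big_ord0.
Qed.

Lemma eq_basis V (U U' : V -> Prop) k (e : 'I_k -> V) :
  (forall v, U v <-> U' v) -> is_basis U e -> is_basis U' e.
Proof.
move=> h [Ue free gen]; split=> // [i|v /h]; last exact: gen.
by apply/h.
Qed.

Lemma eq_findim V (U U' : V -> Prop) :
  (forall v, U v <-> U' v) -> findim U -> findim U'.
Proof. by move=> h [k [e be]]; exists k, e; apply: eq_basis be. Qed.

Lemma eq_trace V (U U' : V -> Prop) (f : {linear V -> V}) :
  (forall v, U v <-> U' v) -> subspace U -> (forall u, U u -> U (f u)) ->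
  findim U -> trace U f = trace U' f.
Proof.
move=> h sU Uf [k [e be]]; have [Ue _ _] := be.
have [A hA] := basis_matrix be (fun i => Uf _ (Ue i)).
have -> : trace U f = \tr A by apply: trace_eq; exists k, e, A.
by apply/esym/trace_eq; exists k, e, A; split=> //; apply: eq_basis be.
Qed.

Lemma trace0 V (U : V -> Prop) (f : {linear V -> V}) :
  (forall v, U v <-> v = 0) -> trace U f = 0.
Proof.
move=> h; apply: trace_eq; exists 0%N, (fun _ => 0), 0; rewrite mxtrace0; split=> //.
  apply: (eq_basis (U := fun v => v = 0)) => [v|]; first by split=> /h.
  split=> [[]|c _ []|v ->] //.
  by exists (fun _ => 0); rewrite big_ord0.
by case.
Qed.

(** The case of [trace_exact] with zero kernel. *)
Lemma trace_iso V W (phi : {linear V -> W}) (U : V -> Prop) (U' : W -> Prop)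
    (f : {linear V -> V}) (g : {linear W -> W}) :
  subspace U -> (forall u, U u -> U (f u)) ->
  (forall u, U u -> phi (f u) = g (phi u)) ->
  (forall u, U u -> phi u = 0 -> u = 0) ->
  (forall w, U' w <-> exists2 u, U u & w = phi u) ->
  findim U' -> trace U f = trace U' g.
Proof.
move=> sU Uf fg inj im fU'.
have K0 v : U v /\ phi v = 0 <-> v = 0.
  split=> [[? ?]|->]; first exact: inj.
  by rewrite linear0; split=> //; case: sU.
rewrite (trace_exact sU (g := g) Uf fg).
- rewrite trace0 // add0r; apply/esym/eq_trace => //.
    by split=> [|a u v /im [u1 U1 ->] /im [v1 V1 ->]]; apply/im;
      [exists 0; [case: sU|rewrite linear0]
      |exists (a *: u1 + v1); [case: sU => _; apply|rewrite linearP]].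
  by move=> w /im [u Uu ->]; apply/im; exists (f u); rewrite ?fg //; apply: Uf.
- by apply: eq_findim (findim0 _) => v; split=> /K0.
- by apply: eq_findim fU' => w.
Qed.

(** Split off [psi ord0]: on its kernel the other functionals still separate points, and its image
    in the base field is zero or a line. *)
Lemma findim_functionals V (N : nat) (psi : 'I_N -> {linear V -> F^o})
    (U : V -> Prop) :
  subspace U -> (forall u, U u -> (forall i, psi i u = 0) -> u = 0) -> findim U.
Proof.
elim: N psi U => [|N IH] psi U sU inj.
  apply: eq_findim (findim0 _) => v; split=> [->|Uv]; first by case: sU.
  by apply: inj => // [[]].
apply: (findim_exact (phi := psi ord0)) => //.
  apply: (IH (fun i => psi (lift ord0 i))).
    exact: subspaceI (subspace_ker _).
  move=> u [Uu u0] h; apply: inj => // i.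
  by case: (unliftP ord0 i) => [j ->|->].
have sI := subspace_im (psi ord0) sU.
have [h|nh] := classic (exists2 u, U u & psi ord0 u <> 0).
  case: h => u Uu /eqP nz; exists 1%N, (fun _ => psi ord0 u : F^o); split.
  - by move=> _; exists u.
  - move=> c; rewrite big_ord1 => /eqP; rewrite scaler_eq0 (negbTE nz) orbF.
    by move=> /eqP h i; rewrite ord1.
  - move=> v _; exists (fun _ => v / psi ord0 u); rewrite big_ord1.
    by rewrite /GRing.scale /= divfK.
apply: eq_findim (findim0 _) => w; split=> [->|[u Uu ->]]; first by case: sI.
by apply: NNPP => h; apply: nh; exists u.
Qed.

End LinearAlgebra.

(** * Generators of the Y-free part *)

Section Generators.

Context {n : nat}.
Implicit Types (d : 'I_n -> nat * nat) (f : 'I_n -> nat).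

Definition upd (A : Type) (g : 'I_n -> A) (i : 'I_n) (a : A) (k : 'I_n) : A :=
  if k == i then a else g k.

(* By multilinearity, both sides are the coefficient of [e] in
   [\det (B + e B')]. *)
Lemma det_derivation (R : comNzRingType) (B B' : 'M[R]_n) :
  \sum_s \det (\matrix_(i, t) (if i == s then B' i t else B i t))
  = \sum_t \det (\matrix_(s, k) (if k == t then B' s k else B s k)).
Proof.
transitivity (\sum_s \sum_t B' s t * cofactor B s t).
  apply: eq_bigr => s _; rewrite (expand_det_row _ s).
  apply: eq_bigr => t _; rewrite !mxE eqxx; congr (_ * _).
  rewrite /cofactor; congr (_ * \det _); apply/matrixP => i k.
  by rewrite !mxE eq_sym (negbTE (neq_lift _ _)).
rewrite exchange_big; apply: eq_bigr => t _; rewrite (expand_det_col _ t).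
apply: eq_bigr => s _; rewrite !mxE eqxx; congr (_ * _).
rewrite /cofactor; congr (_ * \det _); apply/matrixP => i k.
by rewrite !mxE [in RHS]eq_sym (negbTE (neq_lift _ _)).
Qed.

(* Up to a nonzero scalar, the derivative of [Delta] with respect to the monomial
   [\prod_s y_s ^ (f s)], when this has total degree equal to the Y-degree of [Delta]. *)
Definition gen d f : {mpoly rat[n]} :=
  \det (\matrix_(s, t) (((d t).2 == f s)%:R * 'X_s ^+ (d t).1)).

Lemma gen_expand d f :
  gen d f = \sum_(p : 'S_n) ((-1) ^+ p * (\prod_s ((d (p s)).2 == f s))%:R)
                *: 'X_[[multinom (d (p s)).1 | s < n]].
Proof.
apply: eq_bigr => p _; under eq_bigr do rewrite mxE.
rewrite big_split /= -natr_prod mpolyXE_id -mul_mpolyC mpolyCM mpolyC_nat.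
rewrite -mulrA; congr (_ * (_ * _)).
  by rewrite -[in RHS]signr_odd rmorph_sign signr_odd.
by apply: eq_bigr => s _; rewrite mnmE.
Qed.

(** A linear map that factors over the variables on monomials acts on the determinant row by row.
    Derivations, extraction of a coefficient and permutations of the variables are all of this
    kind. *)
Lemma gen_linear k (Phi : {linear {mpoly rat[n]} -> {mpoly rat[k]}})
    (phi : 'I_n -> nat -> {mpoly rat[k]}) d f :
  (forall a : 'I_n -> nat, Phi 'X_[[multinom a s | s < n]] = \prod_s phi s (a s)) ->
  Phi (gen d f) = \det (\matrix_(s, t) (((d t).2 == f s)%:R * phi s (d t).1)).
Proof.
move=> h; rewrite gen_expand linear_sum; apply: eq_bigr => p _.
rewrite linearZ /= (h (fun s => (d (p s)).1)); under [in RHS]eq_bigr do rewrite mxE.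
rewrite big_split /= -natr_prod -mul_mpolyC mpolyCM mpolyC_nat -mulrA.
by congr (_ * _); rewrite -[in RHS]signr_odd rmorph_sign signr_odd.
Qed.

Lemma eq_gen d d' f f' : d =1 d' -> f =1 f' -> gen d f = gen d' f'.
Proof.
by move=> ed ef; congr (\det _); apply/matrixP => s t; rewrite !mxE ed ef.
Qed.

Lemma gen_perm (p : 'S_n) d f : gen (d \o p) f = (-1) ^+ p *: gen d f.
Proof.
rewrite -mul_mpolyC rmorphXn rmorphN1 /gen -(@det_perm _ n p).
set B := (X in _ * \det X); set C := (X in \det X = _).
rewrite -(det_tr C) -(det_tr B) -det_mulmx -row_permE.
by congr (\det _); apply/matrixP => s t; rewrite !mxE.
Qed.

Lemma gen_eq0 d f t t' : t != t' -> d t = d t' -> gen d f = 0.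
Proof.
move=> ne e; rewrite /gen -det_tr.
by apply: (determinant_alternate ne) => s; rewrite !mxE e.
Qed.

Lemma gen_neq0 d f : gen d f != 0 -> exists p : 'S_n, forall s, (d (p s)).2 = f s.
Proof.
move=> nz; apply: NNPP => h; case/negP: nz; apply/eqP.
apply: big1 => p _; suff [s /negbTE ne] : exists s, (d (p s)).2 != f s.
  by rewrite (bigD1 s) //= mxE ne mul0r mul0r mulr0.
apply: NNPP => h'; apply: h; exists p => s; apply/eqP/negPn/negP => ne.
by apply: h'; exists s.
Qed.

Lemma mderivm_gen s k d f :
  (gen d f)^`M(s, k)
  = \det (\matrix_(i, t) (if i == s
      then ((d t).2 == f i)%:R * (((d t).1 ^_ k)%:R * 'X_i ^+ ((d t).1 - k))
      else ((d t).2 == f i)%:R * 'X_i ^+ (d t).1)).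
Proof.
rewrite (gen_linear (Phi := mderivm (U_(s) *+ k)%MM) (phi := fun i a =>
   if i == s then (a ^_ k)%:R * 'X_i ^+ (a - k) else 'X_i ^+ a)).
  by congr (\det _); apply/matrixP => i t; rewrite !mxE; case: (i =P s).
move=> a /=; rewrite mderivnX mnmE -mul_mpolyC mpolyC_nat.
rewrite (bigD1 s) //= eqxx -mulrA; congr (_ * _); rewrite mpolyXE_id (bigD1 s) //=.
rewrite mnmBE mulmnE mnmE mnm1E eqxx mul1n; congr (_ * _).
apply: eq_bigr => i ne; rewrite (negbTE ne) mnmBE mulmnE mnmE mnm1E eq_sym.
by rewrite (negbTE ne) mul0n subn0.
Qed.

(** An instance of [det_derivation]: on rows, [B'] differentiates [k] times in one variable; on
    columns, it lowers one cell by [k] rows. The condition [Q] may be read on either side, since an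
    entry vanishes unless [f s] is the column of [d t]. *)
Lemma gen_power_sum (Q : pred nat) k d f :
  \sum_(s | Q (f s)) (gen d f)^`M(s, k)
  = \sum_(t | Q (d t).2)
      ((d t).1 ^_ k)%:R *: gen (upd d t ((d t).1 - k, (d t).2)%N) f.
Proof.
pose B : 'M[{mpoly rat[n]}]_n :=
  \matrix_(s, t) (((d t).2 == f s)%:R * 'X_s ^+ (d t).1).
pose B' : 'M[{mpoly rat[n]}]_n := \matrix_(s, t)
  ((Q (f s))%:R * (((d t).2 == f s)%:R * (((d t).1 ^_ k)%:R * 'X_s ^+ ((d t).1 - k)))).
rewrite big_mkcond [RHS]big_mkcond /=.
transitivity (\sum_s \det (\matrix_(i, t) (if i == s then B' i t else B i t))).
  apply: eq_bigr => s _; case: ifPn => [Qs|nQ]; last first.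
    rewrite (expand_det_row _ s) big1 // => t _.
    by rewrite !mxE eqxx (negbTE nQ) !mul0r.
  rewrite mderivm_gen; congr (\det _).
  by apply/matrixP => i t; rewrite !mxE; case: (i =P s) => // ->; rewrite Qs mul1r.
rewrite det_derivation; apply: eq_bigr => t _; case: ifPn => [Qt|nQ]; last first.
  rewrite (expand_det_col _ t) big1 // => s _.
  rewrite !mxE eqxx; case: ((d t).2 =P f s) => [<-|_]; last by rewrite !(mul0r, mulr0).
  by rewrite (negbTE nQ) !mul0r.
rewrite -mul_mpolyC mpolyC_nat (expand_det_col _ t) /gen.
rewrite [in RHS](expand_det_col _ t) mulr_sumr; apply: eq_bigr => s _.
have aux (x r y c c' : {mpoly rat[n]}) :
    x = r * y -> c = c' -> x * c = r * (y * c') by move=> -> ->; rewrite mulrA.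
apply: aux.
  rewrite !mxE /upd eqxx /=; case: ((d t).2 =P f s) => [<-|_]; last by rewrite !(mul0r, mulr0).
  by rewrite Qt !mul1r.
rewrite /cofactor; congr (_ * \det _); apply/matrixP => i l.
by rewrite !mxE /upd [lift _ _ == _]eq_sym (negbTE (neq_lift _ _)).
Qed.

(** The second use of [det_derivation]: on rows the column [j] prescribed to one variable becomes
    [c], on columns one cell moves from column [c] to column [j] within its row. *)
Lemma gen_garnir j c d f :
  \sum_(s | f s == j) gen d (upd f s c)
  = \sum_(t | (d t).2 == c) gen (upd d t ((d t).1, j)) f.
Proof.
pose B : 'M[{mpoly rat[n]}]_n :=
  \matrix_(s, t) (((d t).2 == f s)%:R * 'X_s ^+ (d t).1).
pose B' : 'M[{mpoly rat[n]}]_n := \matrix_(s, t)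
  ((f s == j)%:R * ((d t).2 == c)%:R * 'X_s ^+ (d t).1).
rewrite big_mkcond [RHS]big_mkcond /=.
transitivity (\sum_s \det (\matrix_(i, t) (if i == s then B' i t else B i t))).
  apply: eq_bigr => s _; case: ifPn => [Qs|nQ]; last first.
    rewrite (expand_det_row _ s) big1 // => t _.
    by rewrite !mxE eqxx (negbTE nQ) !mul0r.
  congr (\det _); apply/matrixP => i t; rewrite !mxE /upd.
  by case: (i =P s) => // ->; rewrite Qs mul1r.
rewrite det_derivation; apply: eq_bigr => t _; case: ifPn => [Qt|nQ]; last first.
  rewrite (expand_det_col _ t) big1 // => s _.
  by rewrite !mxE eqxx (negbTE nQ) mulr0 !mul0r.
congr (\det _); apply/matrixP => i l; rewrite !mxE /upd; case: (l =P t) => // ->.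
by rewrite Qt mulr1 /= [j == _]eq_sym.
Qed.

End Generators.

(** * Spaces of derivatives, and moves of cells *)

Section DerivativeSpaces.

Context {n : nat}.
Implicit Types (d : 'I_n -> nat * nat) (f : 'I_n -> nat) (A : pred (nat * nat)).

(** The order of enumeration is left free, since it affects [gen] only by a sign; a cell can then be
    moved in place with [upd]. *)
Definition cells_of d A : Prop :=
  injective d /\ forall u, A u <-> exists t, d t = u.

Lemma cells_mem d A t : cells_of d A -> A (d t).
Proof. by move=> [_ h]; apply/h; exists t. Qed.

Lemma eq_cells d A A' : A =1 A' -> cells_of d A -> cells_of d A'.
Proof. by move=> e [inj h]; split=> // u; rewrite -e. Qed.

Lemma cells_upd d A t u : cells_of d A -> ~~ A u ->
  cells_of (upd d t u) (fun v => (v == u) || (A v && (v != d t))).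
Proof.
move=> [inj h] nAu; split.
  move=> x y; rewrite /upd; case: eqP => [->|nx]; case: eqP => [->|ny] // e.
  - by case/negP: nAu; apply/h; exists y.
  - by case/negP: nAu; apply/h; exists x.
  - exact: inj.
move=> v; split=> [/orP[/eqP ->|/andP[/h [k <-] ne]]|[k <-]].
- by exists t; rewrite /upd eqxx.
- exists k; rewrite /upd; case: eqP => // e; by rewrite e eqxx in ne.
rewrite /upd; case: (k =P t) => [_|ne]; first by rewrite eqxx.
apply/orP; right; apply/andP; split; first by apply/h; exists k.
by apply/eqP => /inj.
Qed.

Lemma cells_perm d d' A : cells_of d A -> cells_of d' A ->
  exists p : 'S_n, d' =1 d \o p.
Proof.
move=> [inj h] [inj' h'].
have w t : {k | d k = d' t}.
  by apply: constructive_indefinite_description; apply/h/h'; exists t.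
have winj : injective (fun t => sval (w t)).
  by move=> x y e; apply: inj'; rewrite -(svalP (w x)) -(svalP (w y)) e.
by exists (perm winj) => t /=; rewrite permE (svalP (w t)).
Qed.

Lemma gen_upd_eq0 d A t u f :
  cells_of d A -> A u -> u != d t -> gen (upd d t u) f = 0.
Proof.
move=> [_ h] /h [t' e] ne; apply: (gen_eq0 f (t := t) (t' := t')).
  by apply: contra ne => /eqP ->; rewrite e.
by rewrite /upd eqxx; case: eqP.
Qed.

Definition deriv_space d : {mpoly rat[n]} -> Prop :=
  in_span (fun q => exists f m, q = (gen d f)^`M[m]).

(** The homogeneous component of degree [r], given by derivatives of complementary order so that it
    has explicit generators; [deriv_compP] gives the other description. *)
Definition deriv_comp d (r : nat) : {mpoly rat[n]} -> Prop :=
  in_span (fun q => exists f m,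
    (mdeg m + r = \sum_t (d t).1)%N /\ q = (gen d f)^`M[m]).

Lemma subspace_deriv_space d : subspace (deriv_space d).
Proof. exact: in_span_subspace. Qed.

Lemma subspace_deriv_comp d r : subspace (deriv_comp d r).
Proof. exact: in_span_subspace. Qed.

Lemma mem_gen d f m : deriv_space d (gen d f)^`M[m].
Proof. by apply: mem_span; exists f, m. Qed.

Lemma deriv_space_min d (U : {mpoly rat[n]} -> Prop) :
  subspace U -> (forall f m, U (gen d f)^`M[m]) ->
  forall p, deriv_space d p -> U p.
Proof. by move=> sU h; apply: in_span_min => // _ [f [m ->]]. Qed.

Lemma deriv_space_deriv d p m : deriv_space d p -> deriv_space d p^`M[m].
Proof.
move: p; apply: deriv_space_min => [|f m'].
  exact: (subspace_preim (mderivm m)) (subspace_deriv_space d).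
by rewrite -mderivmDm; apply: mem_gen.
Qed.

Lemma deriv_space_sub d d' :
  (forall f, deriv_space d (gen d' f)) ->
  forall p, deriv_space d' p -> deriv_space d p.
Proof.
move=> h; apply: deriv_space_min => [|f m]; first exact: subspace_deriv_space.
exact: deriv_space_deriv.
Qed.

Lemma eq_deriv_space d d' A p : cells_of d A -> cells_of d' A ->
  deriv_space d p -> deriv_space d' p.
Proof.
move=> hd hd'; have [s e] := cells_perm hd' hd.
apply: deriv_space_sub => f; rewrite (eq_gen e (frefl f)) gen_perm.
apply: subspaceZ; first exact: subspace_deriv_space.
by rewrite -[gen _ _]mderivm0m; apply: mem_gen.
Qed.

Lemma sum_rows_cells d d' A : cells_of d A -> cells_of d' A ->
  (\sum_t (d t).1 = \sum_t (d' t).1)%N.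
Proof.
by move=> hd hd'; have [s e] := cells_perm hd hd'; rewrite [LHS](reindex_inj (@perm_inj _ s));
  apply: eq_bigr => t _; rewrite e.
Qed.

Definition Dsum (p : {mpoly rat[n]}) : {mpoly rat[n]} := \sum_s p^`M(s).

Lemma Dsum_is_linear : linear Dsum.
Proof.
move=> a p q; rewrite /Dsum scaler_sumr -big_split.
by apply: eq_bigr => s _; rewrite linearP.
Qed.

HB.instance Definition _ :=
  GRing.isLinear.Build rat {mpoly rat[n]} {mpoly rat[n]} _ Dsum Dsum_is_linear.

Lemma Dsum_deriv p m : Dsum p^`M[m] = (Dsum p)^`M[m].
Proof.
rewrite /Dsum linear_sum; apply: eq_bigr => s _ /=.
by rewrite -!mderivmU1m -!mderivmDm addmC.
Qed.

Lemma Dsum_gen d f :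
  Dsum (gen d f) = \sum_t (d t).1%:R *: gen (upd d t ((d t).1.-1, (d t).2)) f.
Proof.
transitivity (\sum_(s | predT (f s)) (gen d f)^`M(s, 1)).
  by apply: eq_bigr => s _; rewrite nderivn1.
rewrite gen_power_sum.
by apply: eq_bigr => t _; rewrite ffactn1 subn1.
Qed.

Section Shape.

Variable h : nat -> nat.
Hypothesis anti_h : forall c c', (c <= c')%N -> (h c' <= h c)%N.

Definition shape : pred (nat * nat) := fun u => (u.1 < h u.2)%N.
Definition hole (i j : nat) : pred (nat * nat) :=
  fun u => shape u && (u != (i, j)).

(** A cell lowered within its column either falls below row 0, where the falling factorial vanishes,
    or meets another cell of the shape, and then the determinant has two equal columns. *)
Lemma shape_power_sum d f (Q : pred nat) k : cells_of d shape ->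
  \sum_(s | Q (f s)) (gen d f)^`M(s, k.+1) = 0.
Proof.
move=> hd; rewrite gen_power_sum big1 // => t _.
have := cells_mem t hd; rewrite /shape; case E: (d t) => [r c'] /= ht.
have [rk|kr] := ltnP r k.+1; first by rewrite ffact_small // scale0r.
rewrite (gen_upd_eq0 _ hd) ?scaler0 //; first by rewrite /shape /=; lia.
by rewrite E xpair_eqE; lia.
Qed.

Lemma Dsum_shape d f : cells_of d shape -> Dsum (gen d f) = 0.
Proof.
move=> hd; rewrite Dsum_gen big1 // => t _.
have := cells_mem t hd; rewrite /shape; case E: (d t) => [[|r] c'] /= ht.
  by rewrite scale0r.
rewrite (gen_upd_eq0 _ hd) ?scaler0 //; first by rewrite /shape /=; lia.
by rewrite E xpair_eqE; lia.
Qed.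

(** Column [j] has no cell above the hole, so no cell can descend into it and every lowered cell
    meets another one. *)
Lemma Dsum_hole d f i j : cells_of d (hole i j) -> (h j <= i.+1)%N ->
  Dsum (gen d f) = 0.
Proof.
move=> hd hij; rewrite Dsum_gen big1 // => t _.
have := cells_mem t hd; rewrite /hole /shape; case E: (d t) => [[|r] c'] /=.
  by rewrite scale0r.
rewrite xpair_eqE => ht.
rewrite (gen_upd_eq0 _ hd) ?scaler0 //.
  by rewrite /hole /shape /= xpair_eqE; move: ht; case: (c' =P j) => [->|_]; lia.
by rewrite E xpair_eqE; lia.
Qed.

Lemma cells_hole_move d t i j i' j' : shape (i, j) ->
  cells_of d (hole i j) -> d t = (i', j') ->
  cells_of (upd d t (i, j)) (hole i' j').
Proof.
move=> sij hd e; have := cells_mem t hd; rewrite e /hole => /andP[s' ne].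
have := @cells_upd d _ t (i, j) hd; rewrite /hole eqxx andbF => /(_ isT).
apply: eq_cells => v; rewrite e.
case: (v =P (i, j)) => [->|_] /=; first by rewrite sij eq_sym ne.
by rewrite andbT.
Qed.

(** Only the cell just above the hole can descend without meeting another. Its descent raises the
    hole by one row, with the differentiated exponent [i.+1] as factor. *)
Lemma Dsum_hole_up d i j : shape (i, j) -> (i.+1 < h j)%N -> cells_of d (hole i j) ->
  exists d', cells_of d' (hole i.+1 j) /\
    forall f, Dsum (gen d f) = i.+1%:R *: gen d' f.
Proof.
move=> sij hij hd; have [inj mem] := hd.
have [t0 e0] : exists t, d t = (i.+1, j).
  by apply/mem; rewrite /hole /shape /= xpair_eqE; lia.
exists (upd d t0 (i, j)); split; first exact: cells_hole_move hd e0.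
move=> f; rewrite Dsum_gen (bigD1 t0) //= e0 /= big1 ?addr0 // => t ne.
have := cells_mem t hd; rewrite /hole /shape; case E: (d t) => [[|r] c'] /=.
  by rewrite scale0r.
rewrite xpair_eqE => ht.
have ne' : (r.+1, c') != (i.+1, j).
  by rewrite -E -e0; apply: contra ne => /eqP/inj ->.
rewrite xpair_eqE in ne'.
rewrite (gen_upd_eq0 _ hd) ?scaler0 //.
  rewrite /hole /shape /= xpair_eqE; move: ht ne'.
  by case: (c' =P j) => [->|_]; lia.
by rewrite E xpair_eqE; lia.
Qed.

(** In [gen_garnir] for [d], a cell of column [c] outside row [i] moves onto an occupied place of
    column [j], which is at least as high. Only the cell [(i, c)] survives, and it fills the hole:
    each generator of [d'] is, up to sign, a sum of generators of [d]. *)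
Lemma deriv_space_hole_left d d' i j c p : (j <= c)%N -> (i < h c)%N ->
  cells_of d (hole i j) -> cells_of d' (hole i c) ->
  deriv_space d' p -> deriv_space d p.
Proof.
move=> jc hic hd hd'; have [e|/eqP njc] := eqVneq j c.
  by rewrite -e in hd'; apply: eq_deriv_space hd' hd.
have [inj mem] := hd.
have [t0 e0] : exists t, d t = (i, c).
  by apply/mem; rewrite /hole /shape /= xpair_eqE; lia.
have sij : shape (i, j) by rewrite /shape /=; have := anti_h jc; lia.
have hu := cells_hole_move sij hd e0.
move/(eq_deriv_space hd' hu); move: p; apply: deriv_space_sub => f.
suff -> : gen (upd d t0 (i, j)) f = \sum_(s | f s == j) gen d (upd f s c).
  apply: subspace_sum => [|s _]; first exact: subspace_deriv_space.
  by rewrite -[gen _ _]mderivm0m; apply: mem_gen.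
rewrite gen_garnir (bigD1 t0) ?e0 ?eqxx //= big1 ?addr0 // => t /andP[/eqP ec ne].
have := cells_mem t hd; rewrite /hole /shape => ht.
have ne' : d t != (i, c) by rewrite -e0; apply: contra ne => /eqP/inj ->.
move: ec ht ne'; case E: (d t) => [r c'] /= ec ht; subst c'.
rewrite xpair_eqE eqxx andbT => ne'.
apply: (gen_upd_eq0 _ hd).
  by rewrite /hole /shape /= xpair_eqE; have := anti_h jc; lia.
by rewrite E xpair_eqE; lia.
Qed.

End Shape.
End DerivativeSpaces.

(** * The Tanisaki inverse system *)

Section ElementarySymmetric.

Context {R : comNzRingType}.
Implicit Types s : seq R.

(** The elementary symmetric function of degree [m] of the entries of [s], read off its generating
    polynomial. *)
Definition esy s (m : nat) : R := (\prod_(z <- s) (1 + z *: 'X))`_m.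

Lemma esy_nil m : esy [::] m = (m == 0)%:R.
Proof. by rewrite /esy big_nil coef1. Qed.

Lemma esy_cons0 z s : esy (z :: s) 0 = esy s 0.
Proof. by rewrite /esy big_cons mulrDl mul1r -scalerAl coefD coefZ coefXM mulr0 addr0. Qed.

Lemma esy_consS z s m : esy (z :: s) m.+1 = esy s m.+1 + z * esy s m.
Proof. by rewrite /esy big_cons mulrDl mul1r -scalerAl coefD coefZ coefXM. Qed.

Lemma esy_perm s s' m : perm_eq s s' -> esy s m = esy s' m.
Proof. by move=> h; rewrite /esy (perm_big _ h). Qed.

Lemma esy_oversize s m : (size s < m)%N -> esy s m = 0.
Proof.
elim: s m => [|z s IH] [|m] //=; first by rewrite esy_nil.
by rewrite ltnS esy_consS => h; rewrite !IH ?mulr0 ?addr0 // ltnW.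
Qed.

(** In generating functions, [z / (1 + z X)] times the product over [z :: s] loses the factor
    [1 + z X]. *)
Lemma esy_alternating z s m :
  \sum_(k < m.+1) (-1) ^+ k * z ^+ k.+1 * esy (z :: s) (m - k) = z * esy s m.
Proof.
elim: m => [|m IH]; first by rewrite big_ord1 esy_cons0 mul1r.
rewrite big_ord_recl mul1r subn0 esy_consS.
transitivity (z * (esy s m.+1 + z * esy s m) - z * (z * esy s m)); last by ring.
congr (_ + _); rewrite -IH mulr_sumr -sumrN; apply: eq_bigr => k _.
by rewrite lift0 subSS !exprS; ring.
Qed.

(** Newton's identities, by induction on [s]: the powers of the new entry are handled by
    [esy_alternating]. They turn the power-sum relations of [shape_power_sum] into relations for
    elementary symmetric functions. *)
Lemma newton_identity s m :
  m.+1%:R * esy s m.+1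
  = \sum_(k < m.+1) (-1) ^+ k * (\sum_(z <- s) z ^+ k.+1) * esy s (m - k).
Proof.
elim: s m => [|z s IH] m.
  by rewrite esy_nil mulr0 big1 // => k _; rewrite big_nil mulr0 mul0r.
under eq_bigr do rewrite big_cons mulrDr mulrDl.
rewrite big_split esy_alternating /=.
suff -> : \sum_(k < m.+1) (-1) ^+ k * (\sum_(z <- s) z ^+ k.+1) * esy (z :: s) (m - k)
   = m.+1%:R * esy s m.+1 + m%:R * (z * esy s m) by rewrite esy_consS; ring.
rewrite big_ord_recr /= subnn esy_cons0.
(* This is [z] times the induction hypothesis in one degree less; for [m = 0] both sides vanish. *)
have -> : m%:R * (z * esy s m)
    = \sum_(k < m) (-1) ^+ k * (\sum_(z <- s) z ^+ k.+1) * (z * esy s (m - k.+1)).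
  case: m => [|m]; first by rewrite mul0r big_ord0.
  rewrite mulrCA IH mulr_sumr; apply: eq_bigr => k _.
  by rewrite subSS mulrCA.
rewrite IH big_ord_recr /= subnn addrAC; congr (_ + _).
rewrite -big_split; apply: eq_bigr => k _ /=.
rewrite -mulrDr; have -> : (m - k = (m - k.+1).+1)%N by have := ltn_ord k; lia.
by rewrite esy_consS.
Qed.

End ElementarySymmetric.

(** * Polynomials as differential operators with constant coefficients *)

Section DifferentialAction.

Context {n : nat}.
Implicit Types f g p q : {mpoly rat[n]}.

(** The operator [f(d/dx_1, ..., d/dx_n)] applied to [p]; by [dactM] polynomials become a module
    over polynomials. *)
Definition dact f p : {mpoly rat[n]} := \sum_(m <- msupp f) f@_m *: p^`M[m].

Lemma dactwE k f p : (msize f <= k)%N ->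
  dact f p = \sum_(m : 'X_{1..n < k}) f@_m *: p^`M[m].
Proof.
move=> lt_fk; rewrite /dact (ssrcomplements.big_mksub 'X_{1..n < k}) /=; first last.
- by move=> x /msize_mdeg_lt /leq_trans; apply.
- by rewrite msupp_uniq.
rewrite big_rmcond //= => i.
by move/memN_msupp_eq0 ->; rewrite scale0r.
Qed.

(** Arguments exchanged, so that linearity in the operator can be declared as well. *)
Definition dactl p f := dact f p.

Lemma dact_linear_l p : linear (dactl p).
Proof.
move=> a f g; rewrite /dactl; pose k := maxn (msize (a *: f + g)) (maxn (msize f) (msize g)).
rewrite !(dactwE _ (k := k)) ?leq_max ?leqnn ?orbT //.
rewrite scaler_sumr -big_split; apply: eq_bigr => m _.
by rewrite mcoeffD mcoeffZ scalerDl scalerA.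
Qed.

HB.instance Definition _ p := GRing.isLinear.Build rat {mpoly rat[n]} {mpoly rat[n]}
  _ (dactl p) (dact_linear_l p).

Lemma dact_linear_r f : linear (dact f).
Proof.
move=> a p q; rewrite /dact scaler_sumr -big_split; apply: eq_bigr => m _.
by rewrite linearP scalerDr !scalerA mulrC.
Qed.

HB.instance Definition _ f := GRing.isLinear.Build rat {mpoly rat[n]} {mpoly rat[n]}
  _ (dact f) (dact_linear_r f).

Lemma dactDl f g p : dact (f + g) p = dact f p + dact g p.
Proof. exact: (linearD (dactl p)). Qed.

Lemma dactZl a f p : dact (a *: f) p = a *: dact f p.
Proof. exact: (linearZ_LR (dactl p)). Qed.

Lemma dact_suml (I : Type) (r : seq I) (P : pred I) (F : I -> {mpoly rat[n]}) p :
  dact (\sum_(i <- r | P i) F i) p = \sum_(i <- r | P i) dact (F i) p.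
Proof. exact: (linear_sum (dactl p)). Qed.

Lemma dact0l p : dact 0 p = 0.
Proof. exact: (linear0 (dactl p)). Qed.

Lemma dactX m p : dact 'X_[m] p = p^`M[m].
Proof. by rewrite /dact msuppX big_seq1 mcoeffX eqxx scale1r. Qed.

Lemma dact1 p : dact 1 p = p.
Proof. by rewrite -mpolyX0 dactX mderivm0m. Qed.

Lemma dact_mderivm f p m : dact f p^`M[m] = (dact f p)^`M[m].
Proof.
rewrite /dact linear_sum; apply: eq_bigr => m' _ /=.
by rewrite linearZ /= -!mderivmDm addmC.
Qed.

Lemma dactM f g p : dact (f * g) p = dact f (dact g p).
Proof.
rewrite {1}(mpolyE f) mulr_suml dact_suml {2}/dact; apply: eq_bigr => m _.
rewrite -scalerAl dactZl; congr (_ *: _).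
rewrite {1}(mpolyE g) mulr_sumr dact_suml -dact_mderivm {2}/dact.
apply: eq_bigr => m' _.
by rewrite -scalerAr dactZl -mpolyXD dactX mderivmDm.
Qed.

(** By [newton_identity], [m.+1] times the operator lies in the ideal of the power sums, and [m.+1]
    is invertible in [rat]. *)
Lemma esy_kill (s : seq {mpoly rat[n]}) p m :
  (forall k, dact (\sum_(z <- s) z ^+ k.+1) p = 0) -> dact (esy s m.+1) p = 0.
Proof.
move=> h; have : dact (m.+1%:R * esy s m.+1) p = 0.
  rewrite newton_identity dact_suml big1 // => k _.
  by rewrite mulrAC dactM h linear0.
rewrite -mpolyC_nat mul_mpolyC dactZl => /eqP; rewrite scaler_eq0.
by rewrite Num.Theory.pnatr_eq0 => /eqP.
Qed.

(** Of the products of elementary symmetric functions of [s] and of [s'], only the one of degree 0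
    in [s'] survives. *)
Lemma esy_cat_kill (s s' : seq {mpoly rat[n]}) p m :
  (forall k, dact (esy s' k.+1) p = 0) ->
  dact (esy (s ++ s') m) p = dact (esy s m) p.
Proof.
move=> h; elim: s m => [|z s IH] [|m] /=.
- by congr dact; elim: s' {h} => //= z s' IH; rewrite esy_cons0 IH.
- by rewrite h esy_nil dact0l.
- by rewrite !esy_cons0 IH.
- by rewrite !esy_consS !dactDl !dactM !IH.
Qed.

Definition partials (S : seq 'I_n) : seq {mpoly rat[n]} := [seq 'X_i | i <- S].

(* The inverse system of the Tanisaki ideal of the shape with column heights
   [h 0 >= h 1 >= ...]: Tanisaki's bound [m > |S| - d_|S|] is rewritten in terms
   of the number [n - |S|] of variables outside [S]. *)
Definition tanisaki (h : nat -> nat) p : Prop :=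
  forall S m, uniq S -> (\sum_(c < n - size S) h c < m + (n - size S))%N ->
    dact (esy (partials S) m) p = 0.

Lemma subspace_tanisaki h : subspace (tanisaki h).
Proof.
split=> [S m _ _|a u v hu hv S m uS hS]; first exact: linear0.
by rewrite linearP /= hu // hv // scaler0 addr0.
Qed.

End DifferentialAction.

(** In the step from [q] to [q.+1], an index of [C] that is at least [q] contributes at most [h q]
    and the others fall to induction; without such an index, [C] lies in the initial segment of
    length [q]. *)
Lemma sum_antitone_le (h : nat -> nat) (C : seq nat) q :
  (forall c c', (c <= c')%N -> (h c' <= h c)%N) -> uniq C -> (size C <= q)%N ->
  (\sum_(c <- C) h c <= \sum_(c < q) h c)%N.
Proof.
move=> anti; elim: q C => [|q IH] C uC; first by case: C uC => // _; rewrite big_nil.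
move=> sC; have [/hasP [c cC qc]|/hasPn hC] := boolP (has (fun c => q <= c)%N C).
  rewrite (perm_big _ (perm_to_rem cC)) big_cons big_ord_recr /= addnC leq_add //.
    by apply: IH; rewrite ?rem_uniq ?size_rem //; case: (size C) sC.
  exact: anti.
rewrite big_ord_recr /=; apply: leq_trans (leq_addr _ _).
rewrite -(big_mkord xpredT h) /index_iota subn0.
have sub : {subset C <= iota 0 q} by move=> c /hC; rewrite mem_iota; lia.
have [C' e] : exists C', perm_eq (iota 0 q) (C ++ C').
  exists [seq c <- iota 0 q | c \notin C].
  rewrite perm_sym; apply: perm_trans (permEl (perm_filterC (mem C) _)).
  rewrite perm_cat2r.
  apply: uniq_perm; rewrite ?filter_uniq ?iota_uniq // => c.
  by rewrite mem_filter /=; case: (boolP (c \in C)) => // /(sub c) ->.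
by rewrite (perm_big _ e) big_cat leq_addr.
Qed.

(** * Generators lie in the Tanisaki inverse system *)

Section GeneratorsAreTanisaki.

Context {n : nat}.
Variable h : nat -> nat.
Hypothesis anti_h : forall c c', (c <= c')%N -> (h c' <= h c)%N.

Lemma card_column (d : 'I_n -> nat * nat) c :
  cells_of d (shape h) -> #|[pred t | (d t).2 == c]| = h c.
Proof.
move=> hd; have [inj mem] := hd.
have w (r : 'I_(h c)) : {t | d t = (r : nat, c)}.
  by apply: constructive_indefinite_description; apply/mem; rewrite /shape /=.
have winj : injective (fun r => sval (w r)).
  by move=> r r' e; apply: ord_inj; move: (svalP (w r)); rewrite e (svalP (w r')) => -[].
rewrite -[RHS]card_ord -(card_image winj); apply: eq_card => t.
apply/idP/imageP => [/eqP ct|[r _ ->]]; last by rewrite inE (svalP (w r)) /=.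
have := cells_mem t hd; rewrite /shape ct => hr.
exists (Ordinal hr) => //; apply: inj; rewrite (svalP (w _)) /= -ct.
by case: (d t).
Qed.

(** Let [C] be the set of columns prescribed to the variables outside [S], and split [S] into [B],
    with columns in [C], and [A], with the others. The variables of [A] fill whole columns, so by
    [shape_power_sum] their symmetric functions of positive degree kill [gen d f], and [S] may be
    replaced by [B]. The bound on [m] then gives [size B < m], so that [esy] of degree [m]
    vanishes. *)
Lemma gen_tanisaki (d : 'I_n -> nat * nat) f :
  cells_of d (shape h) -> tanisaki h (gen d f).
Proof.
move=> hd S m uS hS.
have [->|nz] := eqVneq (gen d f) 0; first exact: linear0.
have [p fp] := gen_neq0 nz.
(* As the determinant is nonzero, [f] prescribes each column to exactly as many variables as it has
   cells. *)
have card_f c : #|[pred s | f s == c]| = h c.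
  rewrite -(card_column c hd) -[RHS](card_image (@perm_inj _ p^-1)).
  apply: eq_card => s; apply/idP/imageP => [/eqP fs|[t /eqP ct ->]].
    by exists (p s); rewrite ?permK // inE fp fs.
  by rewrite inE -fp permKV ct.
pose C := undup [seq f s | s <- enum 'I_n & s \notin S].
pose B := [seq s <- S | f s \in C]; pose A := [seq s <- S | f s \notin C].
have eS : perm_eq S (B ++ A) by rewrite perm_sym; apply/permEl/perm_filterC.
have memA s : (s \in A) = (f s \notin C).
  rewrite mem_filter; case: (boolP (f s \in C)) => //= nC.
  apply: contraR nC => nS; rewrite mem_undup; apply: map_f.
  by rewrite mem_filter nS mem_enum.
rewrite (esy_perm (s' := partials B ++ partials A)); last first.
  by rewrite -map_cat; apply: perm_map.
rewrite esy_cat_kill => [|k]; last first.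
  apply: esy_kill => {}k; rewrite big_map dact_suml.
  transitivity (\sum_(s | f s \notin C) (gen d f)^`M(s, k.+1)).
    rewrite -(eq_bigl _ _ memA) -big_uniq ?filter_uniq //.
    by apply: eq_bigr => s _; rewrite mpolyXn dactX.
  exact: (shape_power_sum f (fun c => c \notin C) k hd).
rewrite esy_oversize ?dact0l // size_map.
have card_S : (size [seq s <- enum 'I_n | s \notin S] = n - size S)%N.
  rewrite size_filter -[X in (X - _)%N](size_enum_ord n).
  rewrite -(count_predC (mem S) (enum 'I_n)).
  suff -> : count (mem S) (enum 'I_n) = size S by rewrite addKn.
  rewrite -size_filter; apply: perm_size; apply: uniq_perm.
  - by rewrite filter_uniq ?enum_uniq.
  - by [].
  - by move=> s; rewrite mem_filter mem_enum andbT.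
have hC : (\sum_(c <- C) h c <= \sum_(c < n - size S) h c)%N.
  apply: sum_antitone_le => //; first exact: undup_uniq.
  by apply: leq_trans (size_undup _) _; rewrite size_map card_S.
(* The variables with columns in [C] are those of [B] and all those outside [S]; [C] has at most
   [n - size S] elements, whence the bound [hC]. *)
suff e : (\sum_(c <- C) h c = size B + (n - size S))%N by lia.
transitivity (#|[pred s | f s \in C]|).
  under eq_bigr do rewrite -card_f -sum1_card big_mkcond.
  rewrite exchange_big /= -sum1_card [RHS]big_mkcond; apply: eq_bigr => s _.
  rewrite -big_mkcond sum1_count /= inE.
  have := count_uniq_mem (f s) (undup_uniq [seq f s | s <- enum 'I_n & s \notin S]).
  rewrite -/C => e; transitivity (count_mem (f s) C); last by rewrite e; case: ifP.
  by apply: eq_count => c; rewrite inE eq_sym.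
rewrite -card_S -size_cat cardE; apply/perm_size/uniq_perm.
- exact: enum_uniq.
- rewrite cat_uniq filter_uniq // filter_uniq ?enum_uniq // andbT.
  by apply/hasPn => s; rewrite !mem_filter => /andP[/negbTE -> _]; rewrite andbF.
move=> s; rewrite mem_enum mem_cat (mem_filter _ _ S) mem_filter mem_enum inE andbT.
case: (boolP (s \in S)) => [|nS]; first by rewrite andbT orbF.
rewrite andbF mem_undup; apply: map_f.
by rewrite mem_filter nS mem_enum.
Qed.

Lemma deriv_space_tanisaki (d : 'I_n -> nat * nat) p :
  cells_of d (shape h) -> deriv_space d p -> tanisaki h p.
Proof.
move=> hd; move: p; apply: deriv_space_min => [|f m]; first exact: subspace_tanisaki.
by move=> S k uS hS; rewrite dact_mderivm (gen_tanisaki _ hd) // linear0.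
Qed.

End GeneratorsAreTanisaki.

(** * Coefficients with respect to the first variable *)

Section LeadingCoefficient.

Context {n : nat}.
Implicit Types (p : {mpoly rat[n.+1]}) (m : 'X_{1..n}).

Definition mext (k : nat) m : 'X_{1..n.+1} :=
  [multinom oapp m k (unlift ord0 i) | i < n.+1].

Lemma mext0 k m : mext k m ord0 = k.
Proof. by rewrite mnmE unlift_none. Qed.

Lemma mext_lift k m i : mext k m (lift ord0 i) = m i.
Proof. by rewrite mnmE liftK. Qed.

Lemma mext_surj (M : 'X_{1..n.+1}) :
  M = mext (M ord0) [multinom M (lift ord0 i) | i < n].
Proof.
apply/mnmP => i; case: (unliftP ord0 i) => [j ->|->]; last by rewrite mext0.
by rewrite mext_lift mnmE.
Qed.

Lemma mextD k l m m' : (mext k m + mext l m')%MM = mext (k + l) (m + m')%MM.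
Proof.
apply/mnmP => i; rewrite mnmDE; case: (unliftP ord0 i) => [j ->|->].
  by rewrite !mext_lift mnmDE.
by rewrite !mext0.
Qed.

Lemma mextU i : mext 0 U_(i)%MM = U_(lift ord0 i)%MM.
Proof.
apply/mnmP => l; rewrite mnm1E; case: (unliftP ord0 l) => [j ->|->].
  by rewrite mext_lift mnm1E (inj_eq (@lift_inj _ ord0)).
by rewrite mext0 eq_sym (negbTE (neq_lift _ _)).
Qed.

Lemma mextU0 k : mext k 0%MM = (U_(ord0) *+ k)%MM.
Proof.
apply/mnmP => l; rewrite mulmnE mnm1E; case: (unliftP ord0 l) => [j ->|->].
  by rewrite mext_lift mnm0E (negbTE (neq_lift _ _)).
by rewrite mext0 eqxx mul1n.
Qed.

Lemma mdeg_mext k m : mdeg (mext k m) = (k + mdeg m)%N.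
Proof.
rewrite !mdegE big_ord_recl mext0; congr addn.
by apply: eq_bigr => i _; rewrite mext_lift.
Qed.

(** Coefficient of the [k]-th power of the variable [ord0], as a polynomial in the others. The bound
    on [m] loses nothing, by [mcoeff_coef0]. *)
Definition coef0 (k : nat) p : {mpoly rat[n]} :=
  \sum_(m : 'X_{1..n < msize p}) p@_(mext k m) *: 'X_[m].

Lemma mcoeff_coef0 k p m : (coef0 k p)@_m = p@_(mext k m).
Proof.
have [lt|ge] := ltnP (mdeg m) (msize p); first exact: (mcoeff_mpoly (fun m => p@_(mext k m))).
rewrite [RHS]memN_msupp_eq0; last first.
  by apply/negP => /msize_mdeg_lt; rewrite mdeg_mext; lia.
rewrite /coef0 raddf_sum big1 // => b _ /=; rewrite mcoeffZ mcoeffX.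
case: eqP => [e|_]; last by rewrite mulr0.
by move: ge; rewrite -e leqNgt bmdeg.
Qed.

Lemma coef0_is_linear k : linear (coef0 k).
Proof.
move=> a p q; apply/mpolyP => m.
by rewrite mcoeffD mcoeffZ !mcoeff_coef0 mcoeffD mcoeffZ.
Qed.

HB.instance Definition _ k :=
  GRing.isLinear.Build rat {mpoly rat[n.+1]} {mpoly rat[n]} _ (coef0 k) (coef0_is_linear k).

Lemma coef0_inj p : (forall k, coef0 k p = 0) -> p = 0.
Proof.
by move=> h; apply/mpolyP => M; rewrite (mext_surj M) -mcoeff_coef0 h !mcoeff0.
Qed.

Lemma coef0_msize p k : (msize p <= k)%N -> coef0 k p = 0.
Proof.
move=> h; apply/mpolyP => m; rewrite mcoeff_coef0 mcoeff0 memN_msupp_eq0 //.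
by apply/negP => /msize_mdeg_lt; rewrite mdeg_mext; lia.
Qed.

Lemma coef0_mderiv_lift k p i :
  coef0 k p^`M(lift ord0 i) = (coef0 k p)^`M(i).
Proof.
apply/mpolyP => m; rewrite mcoeff_coef0 !mcoeff_deriv mcoeff_coef0 mext_lift.
by rewrite -mextU mextD addn0.
Qed.

Lemma coef0_mderivm k p m : coef0 k p^`M[mext 0 m] = (coef0 k p)^`M[m].
Proof.
apply/mpolyP => m'; rewrite mcoeff_coef0 !mcoeff_mderivm mcoeff_coef0 mextD.
rewrite big_ord_recl !mext0 ffactn0 mul1n; congr (_ *+ _).
by apply: eq_bigr => i _; rewrite !mext_lift.
Qed.

Lemma coef0_mderiv0 k p : coef0 k p^`M(ord0) = k.+1%:R *: coef0 k.+1 p.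
Proof.
apply/mpolyP => m; rewrite mcoeff_coef0 mcoeff_deriv mcoeffZ mcoeff_coef0 mext0.
rewrite mulr_natl; congr (_@_ _ *+ _).
by have := mextU0 1; rewrite mulm1n => <-; rewrite mextD addn1 addm0.
Qed.

(** The constant is [(k + j)! / k!]; only its being nonzero is recorded. *)
Lemma coef0_mderivn k p j :
  exists2 c : rat, c != 0 & coef0 k p^`M(ord0, j) = c *: coef0 (k + j) p.
Proof.
elim: j p k => [|j IH] p k.
  by exists 1; rewrite ?oner_eq0 // mderivn0 addn0 scale1r.
rewrite mderivSn; have [c nz ->] := IH p^`M(ord0) k.
exists (c * (k + j).+1%:R); first by rewrite mulf_neq0 // Num.Theory.pnatr_eq0.
by rewrite coef0_mderiv0 scalerA addnS.
Qed.

(** Expansion along the row of the first variable, where only the cells [(k, F ord0)] yield the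
    power [k]. Taking a coefficient thus removes a cell from the diagram. *)
Lemma coef0_gen k (d : 'I_n.+1 -> nat * nat) F :
  coef0 k (gen d F)
  = \sum_(t0 | d t0 == (k, F ord0))
      (-1) ^+ t0 *: gen (d \o lift t0) (F \o lift ord0).
Proof.
rewrite (gen_linear (Phi := coef0 k) (phi := fun s a =>
   if unlift ord0 s is Some i then 'X_i ^+ a else (a == k)%:R)); last first.
  move=> a /=; rewrite big_ord_recl unlift_none.
  under eq_bigr do rewrite liftK.
  apply/mpolyP => m; rewrite mcoeff_coef0 mcoeffX -mpolyC_nat mcoeffCM.
  have -> : \prod_(i < n) 'X_i ^+ a (lift ord0 i)
          = 'X_[[multinom a (lift ord0 i) | i < n]] :> {mpoly rat[n]}.
    by rewrite mpolyXE_id; apply: eq_bigr => i _; rewrite mnmE.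
  rewrite mcoeffX -natrM mulnb; congr (_%:R); congr nat_of_bool.
  apply/eqP/andP => [e|[/eqP e0 /eqP e]].
    split; first by rewrite -[a ord0](mnmE a) e mext0.
    by apply/eqP/mnmP => i; rewrite mnmE -[a _](mnmE a) e mext_lift.
  apply/mnmP => l; rewrite mnmE; case: (unliftP ord0 l) => [j ->|->].
    by rewrite mext_lift -e mnmE.
  by rewrite mext0 e0.
rewrite (expand_det_row _ ord0) [RHS]big_mkcond; apply: eq_bigr => t0 _ /=.
rewrite mxE unlift_none -natrM mulnb andbC.
rewrite -[d t0 == _]/(((d t0).1 == k) && ((d t0).2 == F ord0)).
case: ifP => _; last by rewrite mul0r.
rewrite mul1r /cofactor -mul_mpolyC rmorphXn rmorphN1 add0n.
congr (_ * \det _); apply/matrixP => i t.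
by rewrite !mxE liftK.
Qed.

Lemma coef0_gen1 k (d : 'I_n.+1 -> nat * nat) F t0 :
  injective d -> d t0 = (k, F ord0) ->
  coef0 k (gen d F) = (-1) ^+ t0 *: gen (d \o lift t0) (F \o lift ord0).
Proof.
move=> inj e; rewrite coef0_gen (bigD1 t0) ?e //= big1 ?addr0 // => t.
by case/andP => /eqP et /eqP []; apply: inj; rewrite e.
Qed.

Lemma coef0_dact k p (S : seq 'I_n) (m : nat) :
  coef0 k (dact (esy (partials (map (lift ord0) S)) m) p)
  = dact (esy (partials S) m) (coef0 k p).
Proof.
elim: S m => [|i S IH] [|m] /=.
- by rewrite !esy_nil !dact1.
- by rewrite !esy_nil !dact0l linear0.
- by rewrite !esy_cons0 IH.
rewrite !esy_consS !dactDl !dactM !dactX !mderivmU1m linearD /= IH.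
by rewrite coef0_mderiv_lift IH.
Qed.

Section Tanisaki.

Variable h : nat -> nat.
Hypothesis anti_h : forall c c', (c <= c')%N -> (h c' <= h c)%N.

(** For [m' >= m] the relation of degree [m'.+1] for [S] enlarged by the first variable says that
    [esy] of degree [m'.+1] on [S] acts as minus the first derivation after [esy] of degree [m'].
    After [r] steps the degree is [m + r], and the relation for [S] itself applies: it involves one
    more column, of height [h q <= r]. *)
Lemma tanisaki_mderivn p (S : seq 'I_n) (m r : nat) :
  tanisaki h p -> uniq S -> let q := (n - size S)%N in
  (\sum_(c < q) h c < m.+1 + q)%N -> (h q <= r)%N ->
  dact (esy (partials (map (lift ord0) S)) m) p^`M(ord0, r) = 0.
Proof.
move=> hp uS q hq hr.
have sS : (size S <= n)%N.
  by rewrite -[X in (_ <= X)%N](size_enum_ord n) uniq_leq_size // => s _; rewrite mem_enum.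
have uS' : uniq (map (lift ord0) S) by rewrite map_inj_uniq //; apply: lift_inj.
set S' := map (lift ord0) S.
have step (m' : nat) : (m <= m')%N ->
    dact (esy (partials S') m'.+1) p = - (dact (esy (partials S') m') p)^`M(ord0).
  move=> mm'; apply/eqP; rewrite -subr_eq0 opprK.
  rewrite -[_^`M(_)]mderivmU1m -dactX -dactM -dactDl -esy_consS.
  rewrite -[_ :: _]/(partials (ord0 :: S')) hp //.
    rewrite /= uS' andbT; apply/mapP => -[i _ e].
    by have := neq_lift ord0 i; rewrite -e eqxx.
  by rewrite /= size_map subSS -/q; apply: leq_trans hq _; rewrite leq_add2r.
have iter r' : dact (esy (partials S') m) p^`M(ord0, r')
    = (-1) ^+ r' *: dact (esy (partials S') (m + r')) p.
  elim: r' => [|r' IH]; first by rewrite mderivn0 addn0 scale1r.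
  rewrite mderivnS -[_^`M(_)]mderivmU1m dact_mderivm mderivmU1m IH addnS step ?leq_addr //.
  by rewrite mderivZ scalerN exprS mulN1r scaleNr opprK.
rewrite iter hp ?scaler0 // size_map subSn // -/q big_ord_recr /=.
by move: hq hr; move: (\sum_(_ < q) _)%N (h q) => x y; clearbody q; lia.
Qed.

(** The part of the [r]-th derivative free of the first variable is a nonzero multiple of
    [coef0 r p]. *)
Lemma coef0_mderivn_eq0 p r (S : seq 'I_n) (m : nat) :
  dact (esy (partials (map (lift ord0) S)) m) p^`M(ord0, r) = 0 ->
  dact (esy (partials S) m) (coef0 r p) = 0.
Proof.
move=> /(congr1 (coef0 0)); rewrite coef0_dact linear0.
have [c nz ->] := coef0_mderivn 0 p r.
by rewrite linearZ /= add0n => /eqP; rewrite scaler_eq0 (negbTE nz) => /eqP.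
Qed.

(** This is [tanisaki_mderivn] with [S] all the other variables and [m = 0], where [esy] is 1. *)
Lemma tanisaki_coef0_eq0 p r : tanisaki h p -> (h 0 <= r)%N -> coef0 r p = 0.
Proof.
move=> hp hr; have e0 (s : seq {mpoly rat[n]}) : esy s 0 = 1.
  by elim: s => [|z s IH]; rewrite ?esy_nil ?esy_cons0.
rewrite -[LHS]dact1 -(e0 (partials (enum 'I_n))).
have q0 : (n - size (enum 'I_n) = 0)%N by rewrite size_enum_ord subnn.
apply: coef0_mderivn_eq0; apply: tanisaki_mderivn => //.
- exact: enum_uniq.
- by rewrite q0 big_ord0.
- by rewrite q0.
Qed.

Definition cut_col (c0 : nat) (c : nat) : nat := if c == c0 then (h c).-1 else h c.

Lemma sum_cut_col c0 q : (0 < h c0)%N ->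
  (\sum_(c < q) cut_col c0 c + (c0 < q) = \sum_(c < q) h c)%N.
Proof.
move=> h0; elim: q => [|q IH]; first by rewrite !big_ord0.
rewrite !big_ord_recr /= /cut_col -IH ltnS; case: eqP => [->|ne].
  rewrite leqnn ltnn addn0 -addnA; congr addn.
  by case: (h c0) h0 => // x _; rewrite addn1.
rewrite [(c0 <= q)%N]leq_eqVlt eq_sym; case: eqP ne => //= _ _.
by rewrite addnAC.
Qed.

(** Put [q = n - size S]. If [c0 < q], cutting lowers the sum of the first [q] heights by one, and
    [tanisaki_mderivn] applies because [h q <= h c0.+1 <= r]. Otherwise the sum is unchanged: take
    the coefficient of power [r] in the relation for [S] enlarged by the first variable, whose extra
    term involves only [coef0 r.+1 p = 0]. *)
Lemma tanisaki_coef0 p r c0 : tanisaki h p -> coef0 r.+1 p = 0 ->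
  (r < h c0)%N -> (h c0.+1 <= r)%N -> tanisaki (cut_col c0) (coef0 r p).
Proof.
move=> hp p0 rc0 c0r S m uS hS.
have := sum_cut_col (n - size S) (leq_ltn_trans (leq0n r) rc0).
case: (ltnP c0 (n - size S)) => /= hc e.
  apply: coef0_mderivn_eq0; apply: tanisaki_mderivn => //; first by rewrite -e addn1 addSn ltnS.
  exact: leq_trans (anti_h hc) c0r.
rewrite -coef0_dact; have uS' : uniq (map (lift ord0) S).
  by rewrite map_inj_uniq //; apply: lift_inj.
have : dact (esy (partials (ord0 :: map (lift ord0) S)) m) p = 0.
  apply: hp.
    rewrite /= uS' andbT; apply/mapP => -[i _ e'].
    by have := neq_lift ord0 i; rewrite -e' eqxx.
  by rewrite /= size_map subSS -e addn0.
case: m {hS} => [|m] /=; first by rewrite esy_cons0 => ->; rewrite linear0.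
rewrite esy_consS dactDl dactM dactX mderivmU1m => /(congr1 (coef0 r)).
by rewrite linearD linear0 /= coef0_mderiv0 !coef0_dact p0 linear0 scaler0 addr0.
Qed.

End Tanisaki.
End LeadingCoefficient.

(** * The inverse system equals the space of derivatives *)

Lemma corner_exists (h : nat -> nat) r j M : h M = 0%N -> (j <= M)%N -> (r < h j)%N ->
  exists c0, [/\ (j <= c0)%N, (r < h c0)%N & (h c0.+1 <= r)%N].
Proof.
move=> hM jM rj; have ex : exists c, (j <= c)%N && (h c.+1 <= r)%N.
  case: M jM hM => [|M] jM hM; first by move: jM rj; rewrite leqn0 => /eqP ->; rewrite hM.
  have [e|ne] := eqVneq j M.+1; first by rewrite e hM in rj.
  by exists M; rewrite hM leq0n andbT; lia.
have [c0 /andP[jc0 hc0] minc0] := ex_minnP ex.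
exists c0; split=> //; rewrite ltnNge; apply/negP => le.
case: c0 => [|c0] in jc0 hc0 minc0 le *.
  by move: jc0 rj; rewrite leqn0 => /eqP ->; lia.
have [e|ne] := eqVneq j c0.+1; first by rewrite e in rj; lia.
by have := minc0 c0; rewrite le andbT => /(_ ltac:(lia)); lia.
Qed.

Lemma cut_col_anti (h : nat -> nat) c0 :
  (forall c c', (c <= c')%N -> (h c' <= h c)%N) -> (h c0.+1 < h c0)%N ->
  forall c c', (c <= c')%N -> (cut_col h c0 c' <= cut_col h c0 c)%N.
Proof.
move=> anti lt c c' cc'; rewrite /cut_col; have := anti _ _ cc'.
case: (c' =P c0) => [->|n']; case: (c =P c0) => [e|n] //; rewrite ?e; try lia.
by move=> _; have := anti c0.+1 c'; move: cc'; rewrite e; lia.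
Qed.

Lemma shape_cut_col (h : nat -> nat) c0 : (0 < h c0)%N ->
  shape (cut_col h c0) =1 hole h (h c0).-1 c0.
Proof.
move=> h0 [r c]; rewrite /hole /shape /cut_col /= xpair_eqE.
by case: (c =P c0) => [->|_]; lia.
Qed.

(** Induction on [n], then on a strict bound [b] for the degree in the first variable. The
    coefficient of the highest allowed power [r] lies in the inverse system of the shape cut at a
    corner, hence in its space of derivatives; it is lifted to the space of [d] and subtracted. *)
Lemma tanisaki_deriv_space n (d : 'I_n -> nat * nat) (h : nat -> nat) M p :
  (forall c c', (c <= c')%N -> (h c' <= h c)%N) -> h M = 0%N ->
  cells_of d (shape h) -> tanisaki h p -> deriv_space d p.
Proof.
elim: n d h p => [|n IH] d h p anti hM hd hp.
  (* Without variables, [p] is a constant and the generator is the empty determinant 1. *)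
  rewrite (nvar0_mpolyC p) -[_%:MP]mulr1 mul_mpolyC.
  apply: subspaceZ; first exact: subspace_deriv_space.
  by rewrite -(mderivm0m 1) -(det_mx00 (\matrix_(s, t)
    (((d t).2 == 0)%:R * 'X_s ^+ (d t).1))); apply: mem_gen (fun=> 0%N) _.
have : exists b, forall k, (b <= k)%N -> coef0 k p = 0.
  by exists (msize p) => k; apply: coef0_msize.
case=> b; elim: b p hp => [|r IHr] p hp hb.
  rewrite (coef0_inj (p := p)) => [|k]; last exact: hb.
  by case: (subspace_deriv_space d).
have [h0r|rh0] := leqP (h 0) r.
  apply: IHr => // k; rewrite leq_eqVlt => /orP[/eqP <-|]; last exact: hb.
  exact: tanisaki_coef0_eq0 h0r.
have [c0 [_ rc0 c0r]] := corner_exists hM (leq0n M) rh0.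
have hc0 : (0 < h c0)%N by apply: leq_ltn_trans rc0.
have [t0 e0] : exists t, d t = ((h c0).-1, c0).
  by case: hd => _ mem; apply/mem; rewrite /shape /=; lia.
have hd' : cells_of (d \o lift t0) (shape (cut_col h c0)).
  apply: (@eq_cells _ _ (hole h (h c0).-1 c0)) => [u|]; first by rewrite shape_cut_col.
  case: hd => inj mem; split=> [x y /inj/lift_inj //|u]; rewrite /hole; split.
    case/andP => /mem [t <-]; rewrite -e0; case: (unliftP t0 t) => [t' ->|->].
      by move=> _; exists t'.
    by rewrite eqxx.
  case=> t <-; apply/andP; split; first by apply/mem; exists (lift t0 t).
  by rewrite /= -e0; apply/eqP => /inj e; have := neq_lift t0 t; rewrite e eqxx.
have hQ : deriv_space (d \o lift t0) (coef0 r p).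
  apply: (IH _ (cut_col h c0)) => //.
  - by apply: cut_col_anti => //; lia.
  - by rewrite /cut_col hM; case: ifP.
  - by apply: tanisaki_coef0 => //; apply: hb.
(* Subtracting such a [P'] lowers the degree in the first variable and stays in the inverse
   system. *)
suff [P' dP' [eP' hP']] : exists2 P', deriv_space d P' &
    coef0 r p = coef0 r P' /\ forall k, (r < k)%N -> coef0 k P' = 0.
  rewrite -[p](subrK P'); apply: subspaceD => //; first exact: subspace_deriv_space.
  apply: IHr => [|k].
    apply: (subspaceB (U := tanisaki h)) => //; first exact: subspace_tanisaki.
    exact: deriv_space_tanisaki dP'.
  rewrite leq_eqVlt linearB => /orP[/eqP <-|lt] /=; first by rewrite eP' subrr.
  by rewrite hb // hP' // subrr.
move: (coef0 r p) hQ; apply: deriv_space_min => [|f m].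
  have sub0 : subspace (fun P' => deriv_space d P' /\
      forall k, (r < k)%N -> coef0 k P' = 0).
    apply: subspaceI; first exact: subspace_deriv_space.
    split=> [k _|a u v hu hv k rk]; first exact: linear0.
    by rewrite linearP /= hu // hv // scaler0 addr0.
  split=> [|a _ _ [u Uu [-> hu]] [v Uv [-> hv]]].
    by exists 0; [case: (subspace_deriv_space d)|rewrite linear0; split=> // k _; rewrite linear0].
  exists (a *: u + v); first by case: (subspace_deriv_space d) => _; apply.
  by rewrite linearP; split=> // k rk; rewrite linearP /= hu // hv // scaler0 addr0.
(* The first variable is given column [c0], so the corner [t0] yields its highest power [(h c0).-1],
   and [j] derivations bring this down to [r]. *)
pose F i := oapp f c0 (unlift ord0 i).
have F0 : F ord0 = c0 by rewrite /F unlift_none.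
have [inj _] := hd.
pose j := ((h c0).-1 - r)%N.
have [c nz ec] := coef0_mderivn r (gen d F)^`M[mext 0 m] j.
exists (c^-1 * (-1) ^+ t0 *: (gen d F)^`M[mext 0 m]^`M(ord0, j)).
  apply: subspaceZ; first exact: subspace_deriv_space.
  by apply/deriv_space_deriv/mem_gen.
have e0' : d t0 = ((r + j)%N, F ord0) by rewrite e0 F0 /j; congr pair; lia.
split=> [|k rk].
  rewrite linearZ /= ec coef0_mderivm (coef0_gen1 inj e0') mderivmZ !scalerA.
  rewrite [_ * c]mulrAC mulVf // mul1r -expr2 sqrr_sign scale1r.
  by congr (_^`M[_]); apply: eq_gen => // i; rewrite /F /= liftK.
(* A higher power would come from a cell of column [c0] above its top. *)
have [c' _ ec'] := coef0_mderivn k (gen d F)^`M[mext 0 m] j.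
rewrite linearZ /= ec' coef0_mderivm coef0_gen big1 ?linear0 ?scaler0 // => t /eqP et.
case/negP: (negbT (ltnn (k + j))); have := cells_mem t hd.
by rewrite et /shape F0 /= /j; lia.
Qed.

(** The hole is filled by adding a variable: [p] becomes a coefficient of some [R] in the space of
    the full shape, to which the Tanisaki description applies. *)
Lemma deriv_space_hole_ker n (d d' : 'I_n -> nat * nat) (h : nat -> nat) M i j c0 p :
  (forall c c', (c <= c')%N -> (h c' <= h c)%N) -> h M = 0%N ->
  (i < h j)%N -> (i < h c0)%N -> (h c0.+1 <= i)%N ->
  cells_of d (hole h i j) -> cells_of d' (hole h (h c0).-1 c0) ->
  deriv_space d p -> Dsum p = 0 -> deriv_space d' p.
Proof.
move=> anti hM ij ic0 c0i hd hd' dp Dp.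
have h0 : (0 < h c0)%N by apply: leq_ltn_trans ic0.
(* The new first variable goes with the missing cell [(i, j)]. *)
pose e s := oapp d (i, j) (unlift ord0 s).
have e0 : e ord0 = (i, j) by rewrite /e unlift_none.
have el s : e (lift ord0 s) = d s by rewrite /e liftK.
have he : cells_of e (shape h).
  case: (hd) => inj mem; split.
    move=> x y; case: (unliftP ord0 x) => [x' ->|->]; case: (unliftP ord0 y) => [y' ->|->];
      rewrite ?el ?e0 //; first by move/inj => ->.
      by move=> exy; have := cells_mem x' hd; rewrite /hole exy eqxx andbF.
    by move=> exy; have := cells_mem y' hd; rewrite /hole -exy eqxx andbF.
  move=> u; split=> [su|[t <-]].
    have [->|ne] := eqVneq u (i, j); first by exists ord0.
    have [t et] : exists t, d t = u by apply/mem; rewrite /hole su ne.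
    by exists (lift ord0 t); rewrite el.
  case: (unliftP ord0 t) => [t' ->|->]; last by rewrite e0.
  by rewrite el; have := cells_mem t' hd => /andP[].
have [R dR ep] : exists2 R, deriv_space e R & p = coef0 i R.
  move: p dp {Dp}; apply: deriv_space_min => [|f m].
    exact: subspace_im (subspace_deriv_space e).
  pose F s := oapp f j (unlift ord0 s).
  exists (gen e F)^`M[mext 0 m]; first exact: mem_gen.
  rewrite coef0_mderivm (coef0_gen1 (t0 := ord0)); last 2 first.
  - by case: he.
  - by rewrite e0 /F unlift_none.
  rewrite expr0 scale1r; congr (_^`M[_]).
  by apply: eq_gen => s; rewrite /F /= ?el ?liftK.
have DR : Dsum R = 0.
  move: {ep} R dR; apply: deriv_space_min => [|f m]; first exact: subspace_ker.
  by rewrite Dsum_deriv (Dsum_shape f he) linear0.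
(* The coefficient of power [i] in [Dsum R = 0] is [i.+1] times [coef0 i.+1 R] plus [Dsum p], and
   the latter vanishes. *)
have Ri : coef0 i.+1 R = 0.
  move/(congr1 (coef0 i)): DR; rewrite /Dsum big_ord_recl linearD linear0 /=.
  rewrite coef0_mderiv0 [X in _ + X](_ : _ = Dsum p).
    rewrite Dp addr0 => /eqP; rewrite scaler_eq0 Num.Theory.pnatr_eq0.
    by move/eqP.
  rewrite ep linear_sum; apply: eq_bigr => s _ /=.
  by rewrite coef0_mderiv_lift.
apply: (tanisaki_deriv_space (h := cut_col h c0) (M := M)).
- by apply: cut_col_anti => //; lia.
- by rewrite /cut_col hM; case: ifP.
- by apply: eq_cells hd' => u; rewrite shape_cut_col.
rewrite ep; apply: tanisaki_coef0 => //.
exact: deriv_space_tanisaki dR.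
Qed.

(** * Graded characters *)

Section LinearExtension.

Lemma mpoly_lin_ext k (W : lmodType rat) (Phi Psi : {linear {mpoly rat[k]} -> W}) :
  (forall m, Phi 'X_[m] = Psi 'X_[m]) -> Phi =1 Psi.
Proof.
move=> h p; rewrite (mpolyE p) !linear_sum; apply: eq_bigr => m _.
by rewrite !linearZ_LR h.
Qed.

Lemma subst_vars_is_linear k (f : 'I_k -> 'I_k) : linear (subst_vars f).
Proof. by move=> a p q; rewrite /subst_vars linearP. Qed.

HB.instance Definition _ k (f : 'I_k -> 'I_k) :=
  GRing.isLinear.Build rat {mpoly rat[k]} {mpoly rat[k]} _ (subst_vars f)
    (subst_vars_is_linear f).

Definition perm_mnm k (s : 'S_k) (m : 'X_{1..k}) : 'X_{1..k} :=
  [multinom m ((s^-1)%g i) | i < k].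

Lemma mdeg_perm_mnm k (s : 'S_k) m : mdeg (perm_mnm s m) = mdeg m.
Proof.
rewrite !mdegE (reindex_inj (@perm_inj _ s)); apply: eq_bigr => i _.
by rewrite mnmE permK.
Qed.

Lemma subst_varsX k (s : 'S_k) m : subst_vars s 'X_[m] = 'X_[perm_mnm s m].
Proof.
rewrite /subst_vars comp_mpolyX mpolyXE_id [RHS](reindex_inj (@perm_inj _ s)).
by apply: eq_bigr => i _; rewrite tnth_mktuple mnmE permK.
Qed.

Lemma mcoeff_is_linear k (m : 'X_{1..k}) :
  linear (fun p : {mpoly rat[k]} => p@_m : rat^o).
Proof. by move=> a p q; rewrite mcoeffD mcoeffZ. Qed.

Definition mcoeff_form k (m : 'X_{1..k}) (p : {mpoly rat[k]}) : rat^o := p@_m.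

HB.instance Definition _ k (m : 'X_{1..k}) :=
  GRing.isLinear.Build rat {mpoly rat[k]} rat^o _ (mcoeff_form m) (mcoeff_is_linear m).

Lemma mcoeff_subst_vars k (s : 'S_k) p m :
  (subst_vars s p)@_(perm_mnm s m) = p@_m.
Proof.
have := @mpoly_lin_ext k rat^o (mcoeff_form (perm_mnm s m) \o subst_vars s) (mcoeff_form m).
apply=> m'; rewrite /= /mcoeff_form subst_varsX !mcoeffX.
congr (nat_of_bool _)%:R; apply/eqP/eqP => [/mnmP e|->//].
by apply/mnmP => i; have := e (s i); rewrite !mnmE permK.
Qed.

Lemma subst_vars_mderivm k (s : 'S_k) p m :
  subst_vars s p^`M[m] = (subst_vars s p)^`M[perm_mnm s m].
Proof.
apply/mpolyP => m0; have [m' ->] : exists m', m0 = perm_mnm s m'.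
  by exists (perm_mnm s^-1 m0); apply/mnmP => i; rewrite !mnmE invgK permKV.
have e : (perm_mnm s m + perm_mnm s m')%MM = perm_mnm s (m + m')%MM.
  by apply/mnmP => i; rewrite !(mnmE, mnmDE).
rewrite mcoeff_subst_vars !mcoeff_mderivm e mcoeff_subst_vars; congr (_ *+ _).
rewrite [RHS](reindex_inj (@perm_inj _ s)); apply: eq_bigr => i _.
by rewrite ![perm_mnm _ _ _]mnmE permK.
Qed.

Lemma findim_mpoly k (U : {mpoly rat[k]} -> Prop) b :
  subspace U -> (forall p m, U p -> p@_m != 0 -> (mdeg m < b)%N) -> findim U.
Proof.
move=> sU hU; pose T : finType := 'X_{1..k < b}.
apply: (findim_functionals (N := #|T|)
  (psi := fun i => mcoeff_form (bmnm (enum_val i)) : {linear _ -> _})) => // p Up h.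
apply/mpolyP => m; rewrite mcoeff0; apply/eqP/negPn/negP => nz.
have := h (enum_rank (BMultinom (hU _ _ Up nz))).
by rewrite /= /mcoeff_form enum_rankK /= => e; rewrite e eqxx in nz.
Qed.

End LinearExtension.

Section GradedComponents.

Context {n : nat}.
Implicit Types (d : 'I_n -> nat * nat) (f : 'I_n -> nat) (p : {mpoly rat[n]}).

Lemma gen_homog d f : gen d f \is (\sum_t (d t).1)%N.-homog.
Proof.
rewrite gen_expand; apply: rpred_sum => s _; apply: rpredZ; rewrite dhomogX /=.
rewrite mdegE; apply/eqP; rewrite [RHS](reindex_inj (@perm_inj _ s)).
by apply: eq_bigr => i _; rewrite mnmE.
Qed.

Lemma mcoeff_gen_deriv d f m m' :
  (gen d f)^`M[m]@_m' != 0 -> (mdeg m + mdeg m' = \sum_t (d t).1)%N.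
Proof.
rewrite mcoeff_mderivm => nz; rewrite -mdegD; apply/eqP.
apply: contraR nz => ne.
by rewrite (dhomog_nemf_coeff (gen_homog d f) ne) mul0rn.
Qed.

Lemma deriv_comp_homog d r p m : deriv_comp d r p -> p@_m != 0 -> mdeg m = r.
Proof.
move=> dp; suff : forall m, mdeg m != r -> p@_m = 0.
  by move=> h nz; apply/eqP; apply: contraR nz => /h ->.
move: p dp; apply: in_span_min => [|_ [f [m0 [e ->]]] m1 ne].
  split=> [m1 _|a u v hu hv m1 ne]; first by rewrite mcoeff0.
  by rewrite mcoeffD mcoeffZ hu // hv // mulr0 addr0.
apply/eqP; apply: contraR ne => /mcoeff_gen_deriv e'; apply/eqP.
by move: e; rewrite -e' => /addnI.
Qed.

Lemma findim_deriv_comp d r : findim (deriv_comp d r).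
Proof.
apply: (@findim_mpoly _ _ r.+1); first exact: subspace_deriv_comp.
by move=> p m dp /(deriv_comp_homog dp) ->.
Qed.

(** Each derivative of a generator is homogeneous, so the projection to degree [r] fixes it or kills
    it. *)
Lemma deriv_compP d r p :
  deriv_comp d r p <-> deriv_space d p /\ (forall m, p@_m != 0 -> mdeg m = r).
Proof.
split=> [dp|[dp hp]].
  split; last by move=> m; apply: deriv_comp_homog dp.
  move: p dp; apply: in_span_min => [|_ [f [m [_ ->]]]]; last exact: mem_gen.
  exact: subspace_deriv_space.
have -> : p = pihomog mdeg r p.
  rewrite pihomog_dE //; apply/dhomogP => m; rewrite mcoeff_msupp; exact: hp.
move: p dp {hp}; apply: deriv_space_min => [|f m].
  exact: (subspace_preim (pihomog mdeg r)) (subspace_deriv_comp d r).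
have [e|ne] := eqVneq (mdeg m + r)%N (\sum_t (d t).1)%N.
  rewrite pihomog_dE; first by apply: mem_span; exists f, m.
  apply/dhomogP => m'; rewrite mcoeff_msupp => /mcoeff_gen_deriv e'.
  by apply/(@addnI (mdeg m)); rewrite e e'.
suff -> : pihomog mdeg r (gen d f)^`M[m] = 0 by case: (subspace_deriv_comp d r).
rewrite pihomogE big_seq_cond big1 // => m'; rewrite mcoeff_msupp.
case/andP => /mcoeff_gen_deriv e' /eqP er.
by move: ne; rewrite -e' er eqxx.
Qed.

Lemma subst_vars_gen (s : 'S_n) d f :
  subst_vars s (gen d f) = (-1) ^+ s *: gen d (f \o (s^-1)%g).
Proof.
rewrite (gen_linear (Phi := subst_vars s) (phi := fun i a => 'X_(s i) ^+ a)).
  rewrite -mul_mpolyC rmorphXn rmorphN1 /gen -(@det_perm _ n s) -det_mulmx -row_permE.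
  by congr (\det _); apply/matrixP => i t; rewrite !mxE /= permK.
move=> a /=; rewrite subst_varsX mpolyXE_id (reindex_inj (@perm_inj _ s)).
by apply: eq_bigr => i _; rewrite !mnmE permK.
Qed.

Lemma subst_vars_deriv_comp (s : 'S_n) d r p :
  deriv_comp d r p -> deriv_comp d r (subst_vars s p).
Proof.
move: p; apply: in_span_min => [|_ [f [m [e ->]]]].
  exact: (subspace_preim (subst_vars s)) (subspace_deriv_comp d r).
rewrite subst_vars_mderivm subst_vars_gen mderivmZ.
apply: subspaceZ; first exact: subspace_deriv_comp.
by apply: mem_span; exists (f \o (s^-1)%g), (perm_mnm s m); rewrite mdeg_perm_mnm.
Qed.

Lemma subst_vars_Dsum (s : 'S_n) p : subst_vars s (Dsum p) = Dsum (subst_vars s p).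
Proof.
rewrite /Dsum linear_sum [RHS](reindex_inj (@perm_inj _ s)).
apply: eq_bigr => i _ /=; rewrite -!mderivmU1m subst_vars_mderivm.
congr (_^`M[_]); apply/mnmP => j; rewrite !mnmE; congr nat_of_bool; apply/eqP/eqP => [->|<-].
  by rewrite permKV.
by rewrite permK.
Qed.

Definition comp_char d r (s : 'S_n) : rat := trace (deriv_comp d r) (subst_vars s).

Lemma eq_comp_char d d' A r s : cells_of d A -> cells_of d' A ->
  comp_char d r s = comp_char d' r s.
Proof.
move=> hd hd'; apply: (eq_trace (f := subst_vars s)) => [p|||].
- by rewrite !deriv_compP; split=> -[dp hp]; split=> //; apply: eq_deriv_space dp; eassumption.
- exact: subspace_deriv_comp.
- exact: subst_vars_deriv_comp.
- exact: findim_deriv_comp.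
Qed.

(** * The exact sequence given by [Dsum] on a shape with a hole *)

Section Hole.

Variables (h : nat -> nat) (M i j c0 : nat) (d d' : 'I_n -> nat * nat).
Hypothesis anti_h : forall c c', (c <= c')%N -> (h c' <= h c)%N.
Hypothesis hM : h M = 0%N.
Hypothesis ij : (i < h j)%N.
Hypothesis jc0 : (j <= c0)%N.
Hypothesis ic0 : (i < h c0)%N.
Hypothesis c0i : (h c0.+1 <= i)%N.
Hypothesis hd : cells_of d (hole h i j).
Hypothesis hd' : cells_of d' (hole h (h c0).-1 c0).

Lemma Dsum_corner p : deriv_space d' p -> Dsum p = 0.
Proof.
move: p; apply: deriv_space_min => [|f m]; first exact: subspace_ker.
by rewrite Dsum_deriv (Dsum_hole f hd') ?linear0 //; lia.
Qed.

(** [deriv_space_hole_left] carries the hole along row [i] to column [c0]. It then climbs to the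
    top: a generator with the hole one row higher is a nonzero multiple of [Dsum] of a generator. *)
Lemma corner_sub_hole p : deriv_space d' p -> deriv_space d p.
Proof.
suff h1 k e : (i + k < h c0)%N -> cells_of e (hole h (i + k) c0) ->
    forall q, deriv_space e q -> deriv_space d q.
  apply: (h1 ((h c0).-1 - i)%N); first by lia.
  by rewrite (_ : (i + _)%N = (h c0).-1) //; lia.
elim: k e => [|k IH] e ik he.
  by rewrite addn0 in he ik; move=> q; apply: (deriv_space_hole_left anti_h jc0 ic0 hd he).
have [t et] : exists t, e t = ((i + k)%N, c0).
  by case: he => _ mem; apply/mem; rewrite /hole /shape /= xpair_eqE; lia.
have ik' : ((i + k).+1 < h c0)%N by rewrite -addnS.
have he' : cells_of (upd e t ((i + k).+1, c0)) (hole h (i + k) c0).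
  by apply: cells_hole_move et => //; rewrite -addnS.
have [e'' [he'' De]] := Dsum_hole_up (ltnW ik' : shape h ((i + k)%N, c0)) ik' he'.
rewrite addnS in he; move=> q /(eq_deriv_space he he'') dq.
apply: (IH _ _ he'); first exact: ltnW.
move: q dq; apply: deriv_space_sub => f.
rewrite -[gen _ _](scalerK (a := (i + k).+1%:R)) ?Num.Theory.pnatr_eq0 // -De.
apply: subspaceZ; first exact: subspace_deriv_space.
apply: subspace_sum => [|s _]; first exact: subspace_deriv_space.
by rewrite -mderivmU1m; apply: mem_gen.
Qed.

Lemma deriv_comp_ker r p :
  deriv_comp d' r p <-> deriv_comp d r p /\ Dsum p = 0.
Proof.
rewrite !deriv_compP; split=> [[dp hp]|[[dp hp] Dp]].
  by split; [split=> //; apply: corner_sub_hole|apply: Dsum_corner].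
by split=> //; exact: (deriv_space_hole_ker anti_h hM ij ic0 c0i hd hd' dp Dp).
Qed.

Lemma trace_ker r (s : 'S_n) :
  trace (fun p => deriv_comp d r p /\ Dsum p = 0) (subst_vars s) = comp_char d' r s.
Proof.
apply/esym/(eq_trace (f := subst_vars s)); first exact: deriv_comp_ker.
- exact: subspace_deriv_comp.
- exact: subst_vars_deriv_comp.
- exact: findim_deriv_comp.
Qed.

(** By [Dsum_hole] the kernel of [Dsum] is the whole component. *)
Lemma comp_char_top r s : (h j <= i.+1)%N -> comp_char d r s = comp_char d' r s.
Proof.
move=> hj; rewrite -trace_ker; apply: (eq_trace (f := subst_vars s)).
- move=> p; split=> [dp|[]//]; split=> //.
  move: p dp; apply: in_span_min => [|_ [f [m [_ ->]]]]; first exact: subspace_ker.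
  by rewrite Dsum_deriv (Dsum_hole f hd) ?linear0.
- exact: subspace_deriv_comp.
- exact: subst_vars_deriv_comp.
- exact: findim_deriv_comp.
Qed.

(** Constants are killed by [Dsum]. *)
Lemma comp_char0 s : comp_char d 0 s = comp_char d' 0 s.
Proof.
rewrite -trace_ker; apply: (eq_trace (f := subst_vars s)).
- move=> p; split=> [dp|[]//]; split=> //.
  apply: big1 => i0 _; apply/mpolyP => m; rewrite mcoeff0 mcoeff_deriv.
  have [->|/(deriv_comp_homog dp)] := eqVneq p@_(m + U_(i0)) 0; first by rewrite mul0rn.
  by rewrite mdegD mdeg1 addn1.
- exact: subspace_deriv_comp.
- exact: subst_vars_deriv_comp.
- exact: findim_deriv_comp.
Qed.

(** [trace_exact] for [Dsum]: the kernel is [deriv_comp_ker], and since [Dsum] commutes with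
    derivations and sends [gen d f] to a nonzero multiple of [gen e f], the image is the component
    of [e] one degree lower. *)
Lemma comp_charS d'' r s : (i.+1 < h j)%N -> cells_of d'' (hole h i.+1 j) ->
  comp_char d r.+1 s = comp_char d' r.+1 s + comp_char d'' r s.
Proof.
move=> hj hd''; have [e [he De]] := Dsum_hole_up (ij : shape h (i, j)) hj hd.
have nz : i.+1%:R != 0 :> rat by rewrite Num.Theory.pnatr_eq0.
have sum_d : (\sum_t (d t).1 = (\sum_t (e t).1).+1)%N.
  have [t et] : exists t, d t = (i.+1, j).
    by case: hd => _ mem; apply/mem; rewrite /hole /shape /= xpair_eqE; lia.
  have hu := cells_hole_move (ij : shape h (i, j)) hd et.
  rewrite (sum_rows_cells he hu) [LHS](bigD1 t) // [X in X.+1](bigD1 t) //=.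
  rewrite /upd eqxx et /= addSn; congr (_ + _).+1.
  by apply: eq_bigr => k /negbTE ->.
have im w : deriv_comp e r w <-> exists2 p, deriv_comp d r.+1 p & w = Dsum p.
  split=> [|[p dp ->]].
    move: w; apply: in_span_min => [|_ [f [m [em ->]]]].
      exact: (subspace_im Dsum) (subspace_deriv_comp d r.+1).
    exists (i.+1%:R^-1 *: (gen d f)^`M[m]).
      apply: subspaceZ; first exact: subspace_deriv_comp.
      by apply: mem_span; exists f, m; rewrite addnS em sum_d.
    by rewrite linearZ /= Dsum_deriv De mderivmZ scalerK.
  move: p dp; apply: in_span_min => [|_ [f [m [em ->]]]].
    exact: (subspace_preim Dsum) (subspace_deriv_comp e r).
  rewrite Dsum_deriv De mderivmZ; apply: subspaceZ; first exact: subspace_deriv_comp.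
  by apply: mem_span; exists f, m; split=> //; move: em; rewrite sum_d addnS => -[].
rewrite /comp_char (trace_exact (phi := Dsum) (subspace_deriv_comp d r.+1)
  (f := subst_vars s) (g := subst_vars s)).
- rewrite trace_ker; congr (_ + _); rewrite -[RHS](eq_comp_char _ _ he hd'').
  apply/esym/(eq_trace (f := subst_vars s)) => //.
  + exact: subspace_deriv_comp.
  + exact: subst_vars_deriv_comp.
  + exact: findim_deriv_comp.
- exact: subst_vars_deriv_comp.
- by move=> p _; apply/esym/(subst_vars_Dsum s p).
- by apply: eq_findim (findim_deriv_comp d' r.+1) => p; apply: deriv_comp_ker.
- by apply: eq_findim (findim_deriv_comp e r).
Qed.

End Hole.
End GradedComponents.
(** * The Y-free part of [M D] *)

Section YFreePart.

Variable D : diag.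
Let n := #|` D|.
Let d (t : 'I_n) : nat * nat := cell D t.

Lemma cells_diag : cells_of d (mem D).
Proof.
have size_s : size (sort lexle (enum_fset D)) = n by rewrite size_sort.
split=> [t t' /eqP|u].
  rewrite /d /cell nth_uniq ?size_s ?sort_uniq ?fset_uniq // => /eqP.
  exact: ord_inj.
rewrite -[mem D u]/(u \in enum_fset D) -(mem_sort lexle); split.
  by case/(nthP (0%N, 0%N)) => k; rewrite size_s => lt <-; exists (Ordinal lt).
by case=> t <-; apply: mem_nth; rewrite size_s.
Qed.

Definition mjoin (a b : 'X_{1..n}) : 'X_{1..n + n} :=
  [multinom match split k with inl i => a i | inr i => b i end | k < n + n].

Lemma mjoin_l a b i : mjoin a b (lshift n i) = a i.
Proof. by rewrite mnmE (unsplitK (inl i : _ + 'I_n)). Qed.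

Lemma mjoin_r a b i : mjoin a b (rshift n i) = b i.
Proof. by rewrite mnmE (unsplitK (inr i : 'I_n + _)). Qed.

Lemma mjoin_surj m : exists a b, m = mjoin a b.
Proof.
exists [multinom m (lshift n i) | i < n], [multinom m (rshift n i) | i < n].
apply/mnmP => k; rewrite mnmE -[in LHS](splitK k).
by case: (split k) => i /=; rewrite mnmE.
Qed.

Lemma mdeg_mjoin a b : mdeg (mjoin a b) = (mdeg a + mdeg b)%N.
Proof.
rewrite !mdegE big_split_ord; congr addn; apply: eq_bigr => i _.
  by rewrite mjoin_l.
by rewrite mjoin_r.
Qed.

Lemma degX_mjoin a b : degX (mjoin a b) = mdeg a.
Proof. by rewrite /degX mdegE; apply: eq_bigr => i _; rewrite mjoin_l. Qed.

Lemma degY_mjoin a b : degY (mjoin a b) = mdeg b.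
Proof. by rewrite /degY mdegE; apply: eq_bigr => i _; rewrite mjoin_r. Qed.

Lemma mjoinD a b a' b' :
  (mjoin a b + mjoin a' b')%MM = mjoin (a + a')%MM (b + b')%MM.
Proof.
by apply/mnmP => k; rewrite !(mnmE, mnmDE); case: split => i; rewrite mnmDE.
Qed.

Lemma mjoin_inj a b a' b' : mjoin a b = mjoin a' b' -> a = a' /\ b = b'.
Proof.
move/mnmP => e; split; apply/mnmP => i.
  by have := e (lshift n i); rewrite !mjoin_l.
by have := e (rshift n i); rewrite !mjoin_r.
Qed.

Lemma mpolyX_mjoin a b : 'X_[mjoin a b]
  = (\prod_i varX i ^+ a i) * (\prod_i varY i ^+ b i) :> {mpoly rat[n + n]}.
Proof.
rewrite mpolyXE_id big_split_ord; congr (_ * _); apply: eq_bigr => i _.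
  by rewrite mjoin_l.
by rewrite mjoin_r.
Qed.

Let row_mnm (s : 'S_n) : 'X_{1..n} := [multinom (d (s i)).1 | i < n].
Let col_mnm (s : 'S_n) : 'X_{1..n} := [multinom (d (s i)).2 | i < n].

Lemma Delta_expand :
  Delta D = \sum_(s : 'S_n) (-1) ^+ s *: 'X_[mjoin (row_mnm s) (col_mnm s)].
Proof.
apply: eq_bigr => s _; under eq_bigr do rewrite mxE.
rewrite big_split /= mpolyX_mjoin -mul_mpolyC rmorphXn rmorphN1.
by congr (_ * (_ * _)); apply: eq_bigr => i _; rewrite mnmE.
Qed.

Lemma mdeg_row_mnm s : mdeg (row_mnm s) = (\sum_t (d t).1)%N.
Proof.
rewrite mdegE [RHS](reindex_inj (@perm_inj _ s)).
by apply: eq_bigr => i _; rewrite mnmE.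
Qed.

Lemma mdeg_col_mnm s : mdeg (col_mnm s) = (\sum_t (d t).2)%N.
Proof.
rewrite mdegE [RHS](reindex_inj (@perm_inj _ s)).
by apply: eq_bigr => i _; rewrite mnmE.
Qed.

Lemma Delta_bihomog a b : (Delta D)@_(mjoin a b) != 0 ->
  mdeg a = (\sum_t (d t).1)%N /\ mdeg b = (\sum_t (d t).2)%N.
Proof.
move=> nz; apply: NNPP => h; case/negP: nz; apply/eqP.
rewrite Delta_expand raddf_sum big1 // => s _ /=; rewrite mcoeffZ mcoeffX.
case: eqP => [/mjoin_inj [ea eb]|_]; last by rewrite mulr0.
by case: h; rewrite -ea -eb mdeg_row_mnm mdeg_col_mnm.
Qed.

(** Injective on Y-degree 0 by [setY0_inj], this passes from [2n] variables to the [n] variables of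
    [gen]. *)
Definition setY0 (p : {mpoly rat[n + n]}) : {mpoly rat[n]} :=
  p \mPo [tuple (match split k with inl i => 'X_i | inr _ => 0 end) | k < n + n].

Lemma setY0_is_linear : linear setY0.
Proof. by move=> a p q; rewrite /setY0 linearP. Qed.

HB.instance Definition _ :=
  GRing.isLinear.Build rat {mpoly rat[n + n]} {mpoly rat[n]} _ setY0 setY0_is_linear.

Lemma setY0X a b : setY0 'X_[mjoin a b] = (b == 0%MM)%:R *: 'X_[a].
Proof.
rewrite /setY0 comp_mpolyX big_split_ord /=.
under eq_bigr do rewrite tnth_mktuple (unsplitK (inl _ : _ + 'I_n)) mjoin_l.
under [X in _ * X]eq_bigr do rewrite tnth_mktuple (unsplitK (inr _ : 'I_n + _)) mjoin_r.
rewrite -mpolyXE_id; case: eqP => [->|ne].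
  by rewrite scale1r big1 ?mulr1 // => i _; rewrite mnm0E expr0.
have [i bi] : exists i, b i <> 0%N.
  apply: NNPP => h; apply: ne; apply/mnmP => i; rewrite mnm0E.
  by apply: NNPP => bi; apply: h; exists i.
by rewrite scale0r (bigD1 i) //= expr0n; case: eqP bi => // _ _; rewrite mul0r mulr0.
Qed.

Lemma mcoeff_setY0 p a : (setY0 p)@_a = p@_(mjoin a 0%MM).
Proof.
have := @mpoly_lin_ext _ rat^o (mcoeff_form a \o setY0) (mcoeff_form (mjoin a 0%MM)).
apply=> m; have [a' [b' ->]] := mjoin_surj m.
rewrite /= /mcoeff_form setY0X mcoeffZ !mcoeffX -natrM mulnb; congr (nat_of_bool _)%:R.
apply/andP/eqP => [[/eqP -> /eqP ->] //|/mjoin_inj [-> ->]].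
by rewrite !eqxx.
Qed.

Lemma setY0_inj r p : bihomog r 0 p -> setY0 p = 0 -> p = 0.
Proof.
move=> hp p0; apply/mpolyP => m; rewrite mcoeff0; apply/eqP/negPn/negP => nz.
have [a [b e]] := mjoin_surj m.
have [_] := hp m (etrans (mcoeff_msupp p m) nz); rewrite e degY_mjoin => /eqP.
rewrite mdeg_eq0 => /eqP b0; case/negP: nz.
by rewrite e b0 -mcoeff_setY0 p0 mcoeff0.
Qed.

(* Among the terms of the determinant, only those whose columns are prescribed by
   [b] survive both the derivation by [y^b] and the substitution [y = 0]. *)
Lemma setY0_Delta a b :
  setY0 (Delta D)^`M[mjoin a b]
  = (\prod_i (b i)`!)%:R *: (gen d b)^`M[a].
Proof.
have E A B : setY0 'X_[mjoin A B]^`M[mjoin a b]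
    = ((B == b)%:R * (\prod_i (b i)`!)%:R) *: 'X_[A]^`M[a].
  apply/mpolyP => c; rewrite mcoeff_setY0 mcoeffZ !mcoeff_mderivm mjoinD !mcoeffX.
  rewrite addm0 big_split_ord /=.
  under eq_bigr do rewrite !mjoin_l.
  under [X in _ *+ (_ * X)]eq_bigr do rewrite !mjoin_r.
  have [<-|ne] := eqVneq B b; last first.
    rewrite mul0r mul0r; case: eqP => [/mjoin_inj [_ eb]|_]; last by rewrite mul0rn.
    by rewrite eb eqxx in ne.
  have -> : (mjoin A B == mjoin (a + c)%MM B) = (A == (a + c)%MM).
    by apply/eqP/eqP => [/mjoin_inj []|->].
  rewrite mul1r mulrnA -[LHS]mulr_natl; congr (_%:R * _).
  by apply: eq_bigr => i _; rewrite ffactnn.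
rewrite Delta_expand gen_expand (linear_sum (mderivm (mjoin a b))).
rewrite (linear_sum setY0) (linear_sum (mderivm a)) scaler_sumr; apply: eq_bigr => s _.
rewrite !linearZ /= E !scalerA; congr (_ *: _).
rewrite -[RHS]mulrA; congr (_ * (_%:R * _)).
have -> : (col_mnm s == b) = [forall i, (d (s i)).2 == b i].
  apply/eqP/forallP => [/mnmP e i|e]; first by rewrite -e mnmE.
  by apply/mnmP => i; rewrite mnmE; apply/eqP.
case: (boolP [forall i, _]) => [/forallP e|/forallPn [i /negbTE ne]].
  by rewrite big1 // => i _; rewrite e.
by rewrite (bigD1 i) //= ne.
Qed.

Lemma subspace_HM r s : subspace (@HM D r s).
Proof.
apply: subspaceI; first exact: in_span_subspace.
split=> [m|a u v hu hv m]; first by rewrite msupp0.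
rewrite mcoeff_msupp mcoeffD mcoeffZ => nz.
have [u0|nu] := eqVneq u@_m 0; last by apply: hu; rewrite mcoeff_msupp.
by apply: hv; rewrite mcoeff_msupp; apply: contraNneq nz => ->; rewrite u0 mulr0 addr0.
Qed.

(** A nonzero [gen d f] comes from differentiating [Delta D] by the Y-monomial with exponents [f]:
    this uses up the whole Y-degree, so the result is Y-free. The converse is [setY0_Delta]. *)
Lemma setY0_HM r w :
  deriv_comp d r w <-> exists2 u, @HM D r 0 u & w = setY0 u.
Proof.
split=> [|[u [Mu hu] ->]].
  move: w; apply: in_span_min => [|_ [f [m [em ->]]]].
    exact: (subspace_im setY0) (subspace_HM r 0).
  (* For a vanishing generator, [f] need not have the Y-degree of [Delta D] as its sum. *)
  have [->|nz] := eqVneq (gen d f) 0.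
    exists 0; last by rewrite !linear0.
    by case: (subspace_HM r 0).
  have [s es] := gen_neq0 nz.
  pose b : 'X_{1..n} := [multinom f i | i < n].
  have nzb : (\prod_i (b i)`!)%:R != 0 :> rat.
    by rewrite Num.Theory.pnatr_eq0 -lt0n prodn_gt0 // => i; rewrite fact_gt0.
  exists ((\prod_i (b i)`!)%:R^-1 *: (Delta D)^`M[mjoin m b]); last first.
    rewrite linearZ /= setY0_Delta scalerA mulVf // scale1r.
    by congr (_^`M[_]); apply: eq_gen => // i; rewrite mnmE.
  split.
    apply: subspaceZ; first exact: in_span_subspace.
    by apply: mem_span; exists (mjoin m b).
  move=> M; rewrite mcoeff_msupp mcoeffZ mcoeff_mderivm.
  have [a' [b' ->]] := mjoin_surj M; rewrite mjoinD degX_mjoin degY_mjoin => nz'.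
  have nzD : (Delta D)@_(mjoin (m + a')%MM (b + b')%MM) != 0.
    by apply: contraNneq nz' => ->; rewrite mul0rn mulr0.
  have [] := Delta_bihomog nzD; rewrite !mdegD -em => /addnI -> eb; split=> //.
  have : mdeg b = (\sum_t (d t).2)%N.
    rewrite mdegE [RHS](reindex_inj (@perm_inj _ s)).
    by apply: eq_bigr => i _; rewrite mnmE es.
  by move: eb => <- /eqP; rewrite -{1}[mdeg b]addn0 eqn_add2l => /eqP.
apply/deriv_compP; split.
  move: u Mu {hu}; apply: in_span_min => [|_ [M ->]].
    exact: (subspace_preim setY0) (subspace_deriv_space d).
  have [a [b ->]] := mjoin_surj M; rewrite setY0_Delta.
  by apply: subspaceZ; [exact: subspace_deriv_space|exact: mem_gen].
move=> m; rewrite mcoeff_setY0 -mcoeff_msupp => /hu [].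
by rewrite degX_mjoin.
Qed.

Lemma diag_perm_inj (s : 'S_n) : injective (diag_perm s).
Proof.
move=> x y; rewrite /diag_perm -{2}[x]splitK -{2}[y]splitK.
case: (split x) => i; case: (split y) => k /=.
- by move/lshift_inj/perm_inj => ->.
- by move/eqP; rewrite eq_lrshift.
- by move/eqP; rewrite eq_rlshift.
- by move/rshift_inj/perm_inj => ->.
Qed.

Definition diag_sym (s : 'S_n) : 'S_(n + n) := perm (@diag_perm_inj s).

Lemma perm_mnm_mjoin s a b :
  perm_mnm (diag_sym s) (mjoin a b) = mjoin (perm_mnm s a) (perm_mnm s b).
Proof.
apply/mnmP => k0; have [k ->] : exists k, k0 = diag_sym s k.
  by exists ((diag_sym s)^-1 k0)%g; rewrite permKV.
rewrite mnmE permK permE /diag_perm -{1}[k]splitK; case: (split k) => i /=.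
  by rewrite !mjoin_l mnmE permK.
by rewrite !mjoin_r mnmE permK.
Qed.

Lemma subst_vars_diag_perm s p :
  subst_vars (diag_perm s) p = subst_vars (diag_sym s) p.
Proof.
congr comp_mpoly; apply: eq_from_tnth => k.
by rewrite !tnth_mktuple permE.
Qed.

Lemma subst_vars_Delta s :
  subst_vars (diag_perm s) (Delta D) = (-1) ^+ s *: Delta D.
Proof.
rewrite subst_vars_diag_perm Delta_expand (linear_sum (subst_vars (diag_sym s))).
rewrite scaler_sumr [RHS](reindex_inj (mulgI (s^-1)%g)); apply: eq_bigr => q _.
rewrite linearZ /= subst_varsX perm_mnm_mjoin scalerA odd_permM odd_permV.
rewrite signr_addb mulrA -expr2 sqrr_sign mul1r; congr (_ *: 'X_[mjoin _ _]).
  by apply/mnmP => i; rewrite !mnmE permM.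
by apply/mnmP => i; rewrite !mnmE permM.
Qed.

Lemma subst_vars_HM r s p :
  @HM D r 0 p -> @HM D r 0 (subst_vars (diag_perm s) p).
Proof.
case=> Mp hp; split.
  move: p Mp {hp}; apply: in_span_min => [|_ [m ->]].
    exact: (subspace_preim (subst_vars (diag_perm s))) (in_span_subspace _).
  rewrite subst_vars_diag_perm subst_vars_mderivm -subst_vars_diag_perm.
  rewrite subst_vars_Delta mderivmZ; apply: subspaceZ; first exact: in_span_subspace.
  by apply: mem_span; exists (perm_mnm (diag_sym s) m).
move=> m; have [m' ->] : exists m', m = perm_mnm (diag_sym s) m'.
  by exists (perm_mnm (diag_sym s)^-1 m); apply/mnmP => i; rewrite !mnmE invgK permKV.
rewrite subst_vars_diag_perm mcoeff_msupp mcoeff_subst_vars -mcoeff_msupp => /hp.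
have [a [b ->]] := mjoin_surj m'.
by rewrite perm_mnm_mjoin !degX_mjoin !degY_mjoin !mdeg_perm_mnm.
Qed.

Lemma setY0_subst_vars s p :
  setY0 (subst_vars (diag_perm s) p) = subst_vars s (setY0 p).
Proof.
rewrite subst_vars_diag_perm.
apply: (mpoly_lin_ext (Phi := setY0 \o subst_vars (diag_sym s))
                      (Psi := subst_vars s \o setY0)) => m.
have [a [b ->]] := mjoin_surj m.
rewrite /= subst_varsX perm_mnm_mjoin !setY0X linearZ /= subst_varsX.
by rewrite -!mdeg_eq0 mdeg_perm_mnm.
Qed.

Lemma chHM_comp_char r s : @chHM D r 0 s = comp_char d r s.
Proof.
apply: (trace_iso (phi := setY0) (f := subst_vars (diag_perm s)) (g := subst_vars s)).
- exact: subspace_HM.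
- exact: subst_vars_HM.
- by move=> u _; apply: setY0_subst_vars.
- by move=> u [_ hu]; apply: setY0_inj hu.
- exact: setY0_HM.
- exact: findim_deriv_comp.
Qed.

Lemma HM_eq0 r s p : (msize (Delta D) <= r + s)%N -> @HM D r s p -> p = 0.
Proof.
move=> le [Mp hp]; have small m : (msize (Delta D) <= mdeg m)%N -> p@_m = 0.
  move: p Mp {hp} m; apply: in_span_min => [|_ [M ->] m hm].
    split=> [m _|a u v hu hv m hm]; first by rewrite mcoeff0.
    by rewrite mcoeffD mcoeffZ hu // hv // mulr0 addr0.
  rewrite mcoeff_mderivm [_@_(M + m)]memN_msupp_eq0 ?mul0rn //.
  by apply: msize_mdeg_ge; rewrite mdegD; lia.
apply/mpolyP => m; rewrite mcoeff0; apply/eqP/negPn/negP => nz.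
have [a [b e]] := mjoin_surj m; move: (hp m); rewrite mcoeff_msupp => /(_ nz).
rewrite e degX_mjoin degY_mjoin => -[ea eb]; case/negP: nz; apply/eqP/small.
by rewrite e mdeg_mjoin ea eb.
Qed.

Lemma chHM_eq0 r s : (msize (Delta D) <= r)%N -> @chHM D r 0 s = 0.
Proof.
move=> le; apply: (trace0 (subst_vars (diag_perm s))) => p; split.
  by apply: HM_eq0; rewrite addn0.
by move=> ->; case: (subspace_HM r 0).
Qed.

End YFreePart.

(** * Graded Frobenius series *)

Section FrobeniusLinear.

Context {n : nat} (N : nat).
Implicit Types phi psi : 'S_n -> rat.

Lemma eq_frobenius phi psi : phi =1 psi -> frobenius N phi = frobenius N psi.
Proof.
move=> e; apply: eq_bigr => la _; congr (tofrac _%:P *: _).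
by congr (_ * _); apply: eq_bigr => s _; rewrite e.
Qed.

Lemma frobeniusD phi psi :
  frobenius N (fun s => phi s + psi s) = frobenius N phi + frobenius N psi.
Proof.
rewrite /frobenius -big_split; apply: eq_bigr => la _ /=; rewrite -scalerDl.
rewrite -rmorphD -polyCD /char_dot -mulrDr -big_split; congr (tofrac (_ * _)%:P *: _).
by apply: eq_bigr => s _; rewrite mulrDl.
Qed.

Lemma frobenius0 phi : phi =1 (fun=> 0) -> frobenius N phi = 0.
Proof.
move=> h; apply: big1 => la _; rewrite /char_dot big1 => [|s _]; last by rewrite h mul0r.
by rewrite mulr0 rmorph0 scale0r.
Qed.

(** The truncation in [H0] depends on the diagram; a free bound [B] makes series of different
    diagrams comparable. *)
Definition char_series B (chi : nat -> 'S_n -> rat) : {mpoly Qt[N]} :=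
  \sum_(r < B) t ^+ r *: frobenius N (chi r).

Lemma eq_char_series B chi chi' : (forall r s, chi r s = chi' r s) ->
  char_series B chi = char_series B chi'.
Proof.
by move=> e; apply: eq_bigr => r _; congr (_ *: _); apply: eq_frobenius => s.
Qed.

Lemma char_series_widen B B' chi : (B <= B')%N ->
  (forall r s, (B <= r)%N -> chi r s = 0) -> char_series B' chi = char_series B chi.
Proof.
move=> le h0; rewrite /char_series -(subnKC le) big_split_ord /= [X in _ + X]big1 ?addr0 //.
by move=> i _; rewrite frobenius0 ?scaler0 // => s; apply: h0; rewrite leq_addr.
Qed.

Lemma char_series_rec B chi chi' chi'' :
  (forall s, chi 0%N s = chi' 0%N s) ->
  (forall r s, chi r.+1 s = chi' r.+1 s + chi'' r s) ->
  char_series B.+1 chi = char_series B.+1 chi' + t *: char_series B chi''.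
Proof.
move=> h0 hS; rewrite /char_series !big_ord_recl (eq_frobenius h0) -addrA; congr (_ + _).
rewrite scaler_sumr -big_split; apply: eq_bigr => r _ /=.
by rewrite (eq_frobenius (hS r)) frobeniusD scalerDr scalerA -exprS.
Qed.

End FrobeniusLinear.

(** Removing different cells of [mu] gives diagrams of equal cardinality, but in distinct types of
    polynomials. Fixing [n] by an equation puts their characters on one group. *)
Lemma H0_char_series N n (D : diag) (d : 'I_n -> nat * nat) :
  #|` D| = n -> cells_of d (mem D) ->
  exists B0, forall B, (B0 <= B)%N -> H0 N D = char_series N B (comp_char d).
Proof.
move=> e; case: n / e d => d hd; exists (msize (Delta D)) => B le.
have e r s : @chHM D r 0 s = comp_char d r s.
  by rewrite chHM_comp_char; apply: eq_comp_char hd; apply: cells_diag.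
rewrite /H0 -[LHS]/(char_series N _ (fun r => @chHM D r 0)).
rewrite -(char_series_widen N le) => [|r s]; last exact: chHM_eq0.
exact: eq_char_series.
Qed.

(** * Partitions *)

Section Partitions.

Lemma mem_part_diag la r c : ((r, c) \in part_diag la) = (c < nth 0%N la r)%N.
Proof.
rewrite inE; apply/allpairsPdep/idP => [[r' [c' [_ + [-> ->]]]]|lt].
  by rewrite mem_iota.
exists r, c; split=> //; rewrite mem_iota //=.
by rewrite ltnNge; apply: contraL lt => le; rewrite nth_default.
Qed.

Lemma card_part_diag la : #|` part_diag la| = sumn la.
Proof.
rewrite /part_diag card_fseq undup_id; last first.
  apply: allpairs_uniq_dep; first exact: iota_uniq.
    by move=> r _; apply: iota_uniq.
  by move=> [r c] [r' c'] _ _ /= [-> ->].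
rewrite size_allpairs_dep -[in RHS](take_size la) -(map_nth_iota0 0%N (leqnn _)).
by congr sumn; apply: eq_map => r; rewrite size_iota.
Qed.

Lemma exists_cells n (D : diag) : #|` D| = n ->
  exists d : 'I_n -> nat * nat, cells_of d (mem D).
Proof. by move=> e; case: n / e; exists (fun t => cell D t); apply: cells_diag. Qed.

(** In a decreasing sequence the zeros come last, where [nth] has default value 0 anyway. *)
Lemma nth_filter_neq0 (s : seq nat) r : sorted geq s ->
  nth 0%N [seq x <- s | x != 0%N] r = nth 0%N s r.
Proof.
elim: s r => // x s IH r /= px; case: eqP => [x0|_] /=; last first.
  by case: r => // r; apply: IH; apply: path_sorted px.
have /allP s0 : all (geq x) s.
  by apply: order_path_min px => a b c /= ab bc; apply: leq_trans bc ab.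
have z k : nth 0%N s k = 0%N.
  have [lt|ge] := ltnP k (size s); last by rewrite nth_default.
  by have := s0 _ (mem_nth 0%N lt); rewrite x0 /= leqn0 => /eqP.
rewrite IH ?z; last exact: path_sorted px.
by case: r => //= r; rewrite z.
Qed.

Variables (n : nat) (mu : seq nat).
Hypothesis hmu : is_part_of n.+1 mu.

(** The conjugate partition, that is, the column heights. *)
Let h (c : nat) : nat := count (fun x => c < x)%N mu.

Lemma sorted_mu : sorted geq mu.
Proof. by case/and3P: hmu. Qed.

Lemma lt_nth_part r c : (c < nth 0%N mu r)%N = (r < h c)%N.
Proof.
rewrite /h; elim: mu sorted_mu r => [|x s IH] /= px r; first by rewrite nth_nil.
have ps := path_sorted px.
have /allP sx : all (geq x) s.
  by apply: order_path_min px => a b d /= ab bc; apply: leq_trans bc ab.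
case: (ltnP c x) => cx; first by case: r => [|r] //=; rewrite IH // add1n ltnS.
have z : count (fun x => c < x)%N s = 0%N.
  apply/eqP; rewrite -leqn0 leqNgt -has_count; apply/hasPn => y /sx /=.
  by rewrite -leqNgt => yx; apply: leq_trans yx cx.
rewrite z ltn0; case: r => [|r] /=; first by rewrite ltnNge cx.
by rewrite IH // z.
Qed.

Lemma mem_part_shape u : (u \in part_diag mu) = shape h u.
Proof. by case: u => r c; rewrite mem_part_diag lt_nth_part. Qed.

Lemma height_anti c c' : (c <= c')%N -> (h c' <= h c)%N.
Proof. by move=> cc'; apply: sub_count => x /=; apply: leq_ltn_trans. Qed.

Lemma height_eq0 M : (n < M)%N -> h M = 0%N.
Proof.
move=> nM; apply/eqP; rewrite -leqn0 leqNgt -has_count; apply/hasPn => x xmu.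
have : (x <= sumn mu)%N by rewrite (perm_sumn (perm_to_rem xmu)) /= leq_addr.
by case/and3P: hmu => _ _ /eqP ->; lia.
Qed.

Lemma cells_hole_diag (d : 'I_n -> nat * nat) i j :
  cells_of d (mem (part_diag mu `\ (i, j))) <-> cells_of d (hole h i j).
Proof.
have e : mem (part_diag mu `\ (i, j)) =1 hole h i j.
  by move=> u; rewrite /= in_fsetD1 mem_part_shape andbC.
by split; apply: eq_cells.
Qed.

Lemma card_hole u : u \in part_diag mu -> #|` part_diag mu `\ u| = n.
Proof.
move=> uD; have := cardfsD1 u (part_diag mu); rewrite uD card_part_diag.
by case/and3P: hmu => _ _ /eqP -> [].
Qed.

Lemma leg_height i j : leg (part_diag mu) i j = (h j - i.+1)%N.
Proof.
move: (part_diag mu) mem_part_shape => D memD.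
rewrite /leg; have -> : [fset u in D | (u.2 == j) && (i < u.1)%N]
    = [fset u in [seq (r, j) | r <- iota i.+1 (h j - i.+1)]].
  apply/fsetP => -[r c]; rewrite !inE /= memD /shape /=.
  apply/and3P/mapP => [[lt /eqP e ir]|[r' + [-> ->]]].
    by exists r; rewrite ?mem_iota ?e //; rewrite e in lt; lia.
  by rewrite mem_iota eqxx; split=> //; lia.
rewrite card_fseq undup_id ?size_map ?size_iota //.
by rewrite map_inj_uniq ?iota_uniq // => x y [].
Qed.

Lemma arm_gt0 i j : (0 < arm (part_diag mu) i j)%N = (i < h j.+1)%N.
Proof.
move: (part_diag mu) mem_part_shape => D memD.
rewrite cardfs_gt0; apply/fset0Pn/idP => [[[r c]]|lt].
  rewrite !inE /= memD /shape /= => /and3P[rc /eqP e jc].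
  by rewrite -e; apply: leq_trans rc (height_anti jc).
by exists (i, j.+1); rewrite !inE /= memD /shape /= lt eqxx ltnSn.
Qed.

(** The exact sequence of [Dsum] summed over degrees. If [(i.+1, j)] lies outside [mu], the last
    term is 0 by convention and [comp_char_top] suffices. *)
Lemma H0_minus_rec N i j c0 : (i < h j)%N -> (j <= c0)%N -> (i < h c0)%N ->
  (h c0.+1 <= i)%N ->
  H0_minus N mu i j
  = H0_minus N mu (h c0).-1 c0 + t *: H0_minus N mu i.+1 j.
Proof.
move=> ij jc0 ic0 c0i; have hM := height_eq0 (ltnSn n).
have minusE r c : (r < h c)%N ->
    H0_minus N mu r c = H0 N (part_diag mu `\ (r, c)) /\
    exists d : 'I_n -> nat * nat, cells_of d (hole h r c) /\
      exists B0, forall B, (B0 <= B)%N ->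
        H0 N (part_diag mu `\ (r, c)) = char_series N B (comp_char d).
  move=> rc; have rcD : (r, c) \in part_diag mu by rewrite mem_part_shape.
  rewrite /H0_minus rcD; split=> //.
  have [d hd] := exists_cells (card_hole rcD); exists d.
  by split; [apply/cells_hole_diag|apply: H0_char_series (card_hole rcD) hd].
have top : ((h c0).-1 < h c0)%N by case: (h c0) ic0.
have [-> [d [hd [B1 E1]]]] := minusE i j ij.
have [-> [d' [hd' [B2 E2]]]] := minusE _ c0 top.
have [hj|hj] := leqP (h j) i.+1.
  rewrite /H0_minus mem_part_shape /shape /= ltnNge hj /= scaler0 addr0.
  rewrite (E1 _ (leq_maxl B1 B2)) (E2 _ (leq_maxr B1 B2)).
  apply: eq_char_series => r s.
  exact: (comp_char_top height_anti hM ij jc0 ic0 c0i hd hd').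
have [-> [d'' [hd'' [B3 E3]]]] := minusE i.+1 j hj.
(* A common truncation; the left side needs [B.+1], as the factor [t] shifts degrees by one. *)
pose B := maxn B1 (maxn B2 B3).
have le1 : (B1 <= B.+1)%N by rewrite leqW // leq_maxl.
have le2 : (B2 <= B.+1)%N by rewrite leqW // !leq_max leqnn orbT.
have le3 : (B3 <= B)%N by rewrite !leq_max leqnn !orbT.
rewrite (E1 _ le1) (E2 _ le2) (E3 _ le3).
apply: char_series_rec => [s|r s].
  exact: (comp_char0 height_anti hM ij jc0 ic0 c0i hd hd').
exact: (comp_charS height_anti hM ij jc0 ic0 c0i hd hd').
Qed.

(** While the hole climbs column [j], the column [c0] of [H0_minus_rec] is always [j] itself, so the
    same corner term is added at each step and a geometric sum results. *)
Lemma H0_minus_column N i j k : (h j.+1 <= i)%N -> (i + k).+1 = h j ->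
  H0_minus N mu i j = (\sum_(x < k.+1) t ^+ x) *: H0_minus N mu (h j).-1 j.
Proof.
elim: k i => [|k IH] i ji e.
  by rewrite big_ord1 scale1r -e addn0.
rewrite (@H0_minus_rec N i j j) //; try lia.
rewrite (IH i.+1); [|lia|lia].
rewrite scalerA -{1}[H0_minus _ _ _ _]scale1r -scalerDl [in RHS]big_ord_recl mulr_sumr.
by congr ((_ + _) *: _); apply: eq_bigr => x _; rewrite -exprS.
Qed.

Lemma t_expr_neq1 l : (0 < l)%N -> t ^+ l - 1 != 0.
Proof.
move=> l0; rewrite subr_eq0 /t -rmorphXn -(rmorph1 (@tofrac _)) tofrac_eq.
apply/eqP => /(congr1 (fun p : {poly rat} => size p)).
by rewrite size_polyXn size_poly1; case: l l0.
Qed.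

Lemma remove_corner i j : nth 0%N mu i = j.+1 -> (nth 0%N mu i.+1 <= j)%N ->
  exists nu, is_part_of n nu /\ part_diag nu = part_diag mu `\ (i, j).
Proof.
move=> ei ei1; have im : (i < size mu)%N.
  by rewrite ltnNge; apply/negP => le; rewrite nth_default in ei.
pose s := set_nth 0%N mu i j.
have es r : nth 0%N s r = if r == i then j else nth 0%N mu r by rewrite nth_set_nth.
have ss : sorted geq s.
  apply/(sortedP 0%N) => r; rewrite size_set_nth (maxn_idPr im) => lt.
  have := (sortedP 0%N sorted_mu) r lt; rewrite !es /=.
  case: eqP => [e1|_]; case: eqP => [e|_] //; try lia.
    by rewrite e1 ei; lia.
  by rewrite e.
(* The shortened part may have become 0 and is then dropped. *)
pose nu := [seq x <- s | x != 0%N].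
have e : part_diag nu = part_diag mu `\ (i, j).
  apply/fsetP => -[r c]; rewrite in_fsetD1 !mem_part_diag nth_filter_neq0 // es.
  by rewrite xpair_eqE; case: eqP => [->|_] //=; rewrite ei; lia.
exists nu; split=> //; apply/and3P; split.
- by apply: sorted_filter => // a b d /= ab bc; apply: leq_trans bc ab.
- by rewrite mem_filter eqxx.
by rewrite -card_part_diag e card_hole // mem_part_diag ei.
Qed.

End Partitions.

Theorem theorem5p1 (n : nat) (mu : seq nat) (i j : nat) (N : nat)
    (hmu : is_part_of n.+1 mu) (hij : (i, j) \in part_diag mu) :
  let l := leg (part_diag mu) i j in
  let a := arm (part_diag mu) i j in
  [/\ a = 0%N -> (0 < l)%N ->
        H0_minus N mu i j
        = ((t ^+ l.+1 - 1) / (t ^+ l - 1)) *: H0_minus N mu i.+1 j,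
      (0 < a)%N ->
        H0_minus N mu i j
        = H0_minus N mu i j.+1 + t *: H0_minus N mu i.+1 j
          - t *: H0_minus N mu i.+1 j.+1
    & a = 0%N -> l = 0%N ->
        exists nu : seq nat,
          [/\ is_part_of n nu,
              part_diag nu = part_diag mu `\ (i, j)
            & H0_minus N mu i j = H0 N (part_diag nu)]].
Proof.
move=> l a.
pose h c := count (fun x => c < x)%N mu.
have ij : (i < h j)%N by have := hij; rewrite (mem_part_shape hmu).
have la : l = (h j - i.+1)%N by apply: leg_height hmu _ _.
have aE : (0 < a)%N = (i < h j.+1)%N by apply: arm_gt0 hmu _ _.
split.
- move=> a0 l0; rewrite a0 ltnn in aE; move/esym/negbT: aE; rewrite -leqNgt => ji.
  (* Both sides are multiples of the same corner term, by geometric sums of lengths [l.+1] and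
     [l]. *)
  rewrite (@H0_minus_column _ _ hmu N i j l) //; last by rewrite -/(h j); lia.
  rewrite (@H0_minus_column _ _ hmu N i.+1 j l.-1); last 2 first.
  + exact: leqW.
  + by rewrite -/(h j); lia.
  rewrite scalerA prednK //; congr (_ *: _).
  have nz := t_expr_neq1 l0.
  by apply: (mulIf nz); rewrite mulrAC divfK // !subrX1; ring.
- rewrite aE => ij1.
  have [M [hM jM]] : exists M, h M = 0%N /\ (j.+1 <= M)%N.
    exists (maxn n.+1 j.+1); split; last exact: leq_maxr.
    by apply: (height_eq0 hmu); rewrite leq_max ltnSn.
  have [c0 [jc0 ic0 c0i]] := corner_exists hM jM ij1.
  (* One corner column [c0] serves for both [j] and [j.+1], so the corner terms cancel. *)
  rewrite (@H0_minus_rec _ _ hmu N i j c0) //; last exact: ltnW.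
  rewrite (@H0_minus_rec _ _ hmu N i j.+1 c0) //.
  by rewrite addrAC addrK.
- move=> a0 l0; rewrite a0 ltnn in aE; move/esym/negbT: aE; rewrite -leqNgt => ji.
  have [nu [pnu enu]] : exists nu, is_part_of n nu /\ part_diag nu = part_diag mu `\ (i, j).
    apply: remove_corner => //.
      apply/eqP; rewrite eqn_leq; apply/andP; split.
        by rewrite leqNgt (lt_nth_part hmu) -leqNgt.
      by rewrite (lt_nth_part hmu).
    by rewrite leqNgt (lt_nth_part hmu) -leqNgt -/(h j); lia.
  by exists nu; split=> //; rewrite /H0_minus hij enu.
Qed.
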